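(* Let $\mathbb K$ be an algebraically closed field of characteristic $p>2$. Let $\Lambda_1,\dots,\Lambda_n\in\mathbb F_p^\times\subset\mathbb K$, let $a\in\mathbb K\setminus\mathbb F_p$, and let $x^0=(x^0_1,\dots,x^0_n)\in\mathbb K^n$ be such that all $2np$ linear factors in $s$ in the numerator and denominator of $$\prod_{i=1}^n\prod_{j=0}^{p-1}\frac{s-x_i^0+\Lambda_i+aj}{s-x_i^0+aj}$$ are pairwise distinct. Then for generic $\kappa\in\mathbb K^\times$, the Bethe ansatz equation $$\kappa^p\prod_{i=1}^n\frac{h_p(s-x_i^0+\Lambda_i)}{h_p(s-x_i^0)}=1,\qquad h_p(u)=u^p-a^{p-1}u,$$ has $n$ distinct solutions $s_1^0,\dots,s_n^0$, obtained by deforming the roots $y_1^0,\dots,y_n^0$, where $y_i^0=x_i^0-\Lambda_i$, such that the corresponding vectors $J(s_i^0,x^0)$, $i=1,\dots,n$, are nonzero and form a basis of $V_{\mathbb K}$. Moreover, each $J(s_i^0,x^0)$ is a common eigenvector of the $p$-curvature operators $\tilde K_m(x^0)$, $m=1,\dots,n$, with respective eigenvalues $$-\,\frac{h_p(s_i^0-x_m^0)}{h_p(s_i^0-x_m^0+\Lambda_m)},$$ that is, $$\tilde K_m(x^0)J(s_i^0,x^0)=-\,\frac{h_p(s_i^0-x_m^0)}{h_p(s_i^0-x_m^0+\Lambda_m)}\,J(s_i^0,x^0),\qquad m=1,\dots,n.$$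
   Context: $\mathbb F_p$ is the prime subfield of $\mathbb K$, $n\ge1$, and $f_1,\dots,f_n$ is the standard basis of $\mathbb Z^n$; $x+af_m$ is $x=(x_1,\dots,x_n)$ with the $m$-th coordinate increased by $a$. Fiber. $\mathfrak{gl}_2$ over $\mathbb K$ has standard generators $e_{ij}$; set $e=e_{12}$, $f=e_{21}$, $h_1=e_{11}$, $h_2=e_{22}$. $M_\Lambda$ is the Verma module with basis $f^kv_\Lambda$, $k\ge0$, where $ev_\Lambda=0$, $h_1v_\Lambda=\Lambda v_\Lambda$, $h_2v_\Lambda=0$. $V_{\mathbb K}$ is the weight subspace of $M_{\Lambda_1}\otimes\dots\otimes M_{\Lambda_n}$ of weight $[\sum_j\Lambda_j-1,1]$, i.e. the $n$-dimensional subspace with basis $f^{(j)}=v_{\Lambda_1}\otimes\dots\otimes fv_{\Lambda_j}\otimes\dots\otimes v_{\Lambda_n}$, $j=1,\dots,n$. $R$-matrix. $R_{\Lambda_1,\Lambda_2}(x)\in\mathrm{End}(M_{\Lambda_1}\otimes M_{\Lambda_2})(x)$ is the rational $\mathfrak{gl}_2$ $R$-matrix; it fixes $v_{\Lambda_1}\otimes v_{\Lambda_2}$, and in the basis $fv_{\Lambda_1}\otimes v_{\Lambda_2},\ v_{\Lambda_1}\otimes fv_{\Lambda_2}$ it equals $$\frac1{x-\Lambda_1}\begin{pmatrix}x-\Lambda_1+\Lambda_2&-\Lambda_2\\-\Lambda_1&x\end{pmatrix}$$ (only these weight subspaces are needed here). $R^{(i,j)}_{\Lambda_i,\Lambda_j}$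 denotes its action on the $i$-th and $j$-th tensor factors (first factor of $R$ on the $i$-th). $\kappa^{h_2^{(m)}}$ acts on $V_{\mathbb K}$ by $f^{(m)}\mapsto\kappa f^{(m)}$ and $f^{(j)}\mapsto f^{(j)}$ for $j\neq m$. qKZ functions with values in $\mathrm{GL}(V_{\mathbb K})$ and step $a$: $$K_m(x)=R^{(m,m-1)}_{\Lambda_m,\Lambda_{m-1}}(x_m-x_{m-1}+a)\cdots R^{(m,1)}_{\Lambda_m,\Lambda_1}(x_m-x_1+a)\,\kappa^{h_2^{(m)}}\,R^{(m,n)}_{\Lambda_m,\Lambda_n}(x_m-x_n)\cdots R^{(m,m+1)}_{\Lambda_m,\Lambda_{m+1}}(x_m-x_{m+1}).$$ The $p$-curvature operators are $\tilde K_m(x)=K_m(x+(p-1)af_m)\cdots K_m(x+af_m)K_m(x)$. Bethe vector. $\Phi(s,x)=\kappa\prod_{i=1}^n\frac{s-x_i+\Lambda_i}{s-x_i+a}$; $W(s,x)=\sum_{j=1}^nW_j(s,x)f^{(j)}$ with $W_j(s,x)=\prod_{l<j}(s-x_l+\Lambda_l)\prod_{l>j}(s-x_l)$; and $$J(s,x)=\sum_{d=0}^{p-1}W(s+da,x)\prod_{j=0}^{d-1}\Phi(s+aj,x).$$ Deformation of roots. With $\varepsilon=\kappa^{-1}$ the Bethe ansatz equation is rewritten as $$\prod_{i=1}^n\prod_{j=0}^{p-1}(s-x_i^0+\Lambda_i+aj)=\varepsilon^p\prod_{i=1}^n\prod_{j=0}^{p-1}(s-x_i^0+aj).$$ At $\varepsilon=0$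 it has only simple roots, among them $y_i^0=x_i^0-\Lambda_i$, $i=1,\dots,n$; through each $(0,y_i^0)$ passes a unique formal branch $s_i(\varepsilon)\in\mathbb K[[\varepsilon]]$ of solutions with $s_i(0)=y_i^0$. ''Obtained by deforming the roots $y_1^0,\dots,y_n^0$'' refers to these branches.
   Formalization: The eigenvalue is stated as +h_p(s_i-x_m)/h_p(s_i-x_m+Λ_m) instead of with the minus sign: for n=1 the operator is κ^p, which by the Bethe equation equals this quotient, so the printed sign would force 2κ^p=0, impossible for p>2. *)

(* Defs.v *)
From mathcomp Require Export all_boot all_order all_algebra.
From mathcomp Require Export mpoly.

Set Implicit Arguments.
Unset Strict Implicit.
Unset Printing Implicit Defensive.

Import GRing.Theory.
Local Open Scope ring_scope.

(* Membership in the prime subfield, i.e. in the image of 'F_p in K; meant for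
   a field K of characteristic p. *)
Definition in_Fp (K : fieldType) (p : nat) (z : K) : bool :=
  [exists c : 'F_p, z == (c : nat)%:R].

Definition shift (K : fieldType) (n : nat) (x : 'I_n -> K) (m : 'I_n) (c : K)
    : 'I_n -> K :=
  fun i => if i == m then x i + c else x i.

(* The fiber V_K is 'cV[K]_n: the basis vector f^(j), with f v_j in the j-th
   factor and highest weight vectors elsewhere, is delta_mx j 0.  Operators on
   V_K are the matrices 'M[K]_n acting by left multiplication on columns, so
   that the l-th column of an operator is the image of f^(l). *)

(* The R-matrix R_{l1,l2}(u) in the basis (f v (x) v, v (x) f v). *)
Definition Rblock (K : fieldType) (l1 l2 u : K) : 'M[K]_2 :=
  (u - l1)^-1 *:
  \matrix_(r < 2, c < 2)
    (if r == 0 then (if c == 0 then u - l1 + l2 else - l2)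
     else (if c == 0 then - l1 else u)).

(* R^{(i,j)}(u) on V_K, for i != j: it preserves the span of f^(i) and f^(j),
   where it is the 2 x 2 block with f^(i) as first basis vector.  It fixes every
   other f^(l), which has v (x) v in the i-th and j-th factors. *)
Definition Rop (K : fieldType) (n : nat) (Lam : 'I_n -> K) (i j : 'I_n) (u : K)
    : 'M[K]_n :=
  let pos (k : 'I_n) : 'I_2 := if k == i then 0 else 1 in
  \matrix_(k, l)
    (if (k \in pred2 i j) && (l \in pred2 i j)
     then Rblock (Lam i) (Lam j) u (pos k) (pos l)
     else (k == l)%:R).

Definition kappa_h2 (K : fieldType) (n : nat) (kappa : K) (m : 'I_n) : 'M[K]_n :=
  diag_mx (\row_j (if j == m then kappa else 1)).

(* The products run over decreasing indices: m-1, ..., 1, and n, ..., m+1. *)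
Definition qKZ (K : fieldType) (n : nat) (Lam : 'I_n -> K) (a kappa : K)
    (m : 'I_n) (x : 'I_n -> K) : 'M[K]_n :=
  (\big[mulmx/1%:M]_(j <- rev (enum 'I_n) | (j < m)%N)
      Rop Lam m j (x m - x j + a))
  *m kappa_h2 kappa m
  *m (\big[mulmx/1%:M]_(j <- rev (enum 'I_n) | (m < j)%N)
      Rop Lam m j (x m - x j)).

(* For n = 1 this is the scalar kappa ^+ p.  Together with the Bethe ansatz
   equation this fixes the sign of the eigenvalue on a Bethe vector: it is
   + h_p(s - x_m) / h_p(s - x_m + Lam_m). *)
Definition p_curvature (K : fieldType) (p n : nat) (Lam : 'I_n -> K)
    (a kappa : K) (m : 'I_n) (x : 'I_n -> K) : 'M[K]_n :=
  \big[mulmx/1%:M]_(k <- rev (iota 0 p)) qKZ Lam a kappa m (shift x m (a *+ k)).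

Definition Phi (K : fieldType) (n : nat) (Lam : 'I_n -> K) (a kappa : K)
    (x : 'I_n -> K) (s : K) : K :=
  kappa * \prod_(i < n) ((s - x i + Lam i) / (s - x i + a)).

Definition W (K : fieldType) (n : nat) (Lam : 'I_n -> K)
    (x : 'I_n -> K) (s : K) : 'cV[K]_n :=
  \col_j ((\prod_(l < n | (l < j)%N) (s - x l + Lam l)) *
          (\prod_(l < n | (j < l)%N) (s - x l))).

Definition bethe_vector (K : fieldType) (p n : nat) (Lam : 'I_n -> K)
    (a kappa : K) (x : 'I_n -> K) (s : K) : 'cV[K]_n :=
  \sum_(d < p)
    (\prod_(j < d) Phi Lam a kappa x (s + a *+ j)) *: W Lam x (s + a *+ d).

Definition h_p (K : fieldType) (p : nat) (a u : K) : K :=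
  u ^+ p - a ^+ p.-1 * u.

(* As 0^-1 = 0, a solution has all the denominators nonzero. *)
Definition bethe_equation (K : fieldType) (p n : nat) (Lam : 'I_n -> K)
    (a kappa : K) (x : 'I_n -> K) (s : K) : Prop :=
  kappa ^+ p *
    \prod_(i < n) (h_p p a (s - x i + Lam i) / h_p p a (s - x i)) = 1.

(* The 2np linear factors in s: those of the numerator have first index true,
   those of the denominator false. *)
Definition linear_factor (K : fieldType) (p n : nat) (Lam : 'I_n -> K) (a : K)
    (x : 'I_n -> K) (t : bool * 'I_n * 'I_p) : {poly K} :=
  let: (num, i, j) := t in
  'X - (x i)%:P + (if num then Lam i else 0)%:P + (a *+ j)%:P.

(* A formal power series in K[[eps]] is given by its sequence of coefficients.
   A polynomial relation over K[eps] holds between series if and only if, for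
   every N, it holds modulo eps^N between their truncations at order N. *)
Definition trunc (K : fieldType) (g : nat -> K) (N : nat) : {poly K} :=
  \poly_(k < N) g k.

(* g in K[[eps]] solves
     \prod_(i, j) (g - x_i + Lam_i + a j) = eps^p \prod_(i, j) (g - x_i + a j)
   and has constant term x_i - Lam_i; here eps is the variable 'X. *)
Definition is_branch (K : fieldType) (p n : nat) (Lam : 'I_n -> K) (a : K)
    (x : 'I_n -> K) (i : 'I_n) (g : nat -> K) : Prop :=
  g 0%N = x i - Lam i /\
  forall N : nat,
    'X^N %| \prod_(l < n) \prod_(j < p)
               (trunc g N - (x l)%:P + (Lam l)%:P + (a *+ j)%:P)
            - 'X^p * \prod_(l < n) \prod_(j < p)
               (trunc g N - (x l)%:P + (a *+ j)%:P).

(* The point (eps0, s_1, ..., s_n) of K^(n+1) is a specialization of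
   (eps, sigma_1(eps), ..., sigma_n(eps)): every polynomial relation over K
   between eps and the series sigma_i persists at the point.  This is what gives
   a meaning to the values of the series sigma_i, which are algebraic over
   K(eps), at a point eps0 of a field K without topology.  A relation is a
   polynomial F in S_1, ..., S_n with coefficients in K[eps]. *)
Definition specializes (K : fieldType) (n : nat) (sigma : 'I_n -> nat -> K)
    (eps0 : K) (s : 'I_n -> K) : Prop :=
  forall F : {mpoly {poly K}[n]},
    (forall N : nat, 'X^N %| F.@[fun i => trunc (sigma i) N]) ->
    (F.@[fun i => (s i)%:P]).[eps0] = 0.

(* Main.v *)
From mathcomp Require Import ring zify perm.
From Stdlib Require Import Classical FunctionalExtensionality.
Require Import Defs.

Set Implicit Arguments.
Unset Strict Implicit.
Unset Printing Implicit Defensive.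

Import GRing.Theory.
Local Open Scope ring_scope.

(* The vector [W(s, x)] is attached to the order [1, ..., n] of the tensor
   factors, and [R^(m,k)] moves the factor [m] past the factor [k].  Hence
   [K_m(x) W(s, x)] is a multiple of [W(s, x + a f_m)] up to a discrete derivative
   in [s]; summed over [s, s + a, ..., s + (p - 1) a] the derivative telescopes to
   zero by the Bethe equation, so that [K_m(x) J(s, x)] is a multiple of
   [J(s, x + a f_m)], and [J] is an eigenvector of the p-curvature.

   The Bethe equation [kappa^p P(s) = Q(s)] depends on [s] through [h_p(s)] only.
   Eliminating [kappa] shows that [J(s, x)] vanishes, or that [s] is a multiple
   root, for finitely many [kappa] only.  Otherwise the values [h_p(s_i)], and with
   them the eigenvalues, are distinct, and the [J(s_i, x)] form a basis.

   The branches come from Hensel's lemma.  They have a specialization at every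
   [eps0] with [eps0^p != 1]: if each of the finitely many tuples of roots at
   [eps0] violated a relation between the branches, then one relation would be
   violated by all of them, and its norm, a symmetric function of the roots, would
   vanish identically in [eps] but not at [eps0]. *)

(** * The off-shell Bethe identity *)

Section OffShellBethe.

Variables (K : fieldType) (n : nat) (Lam : 'I_n -> K).

(* The Bethe vector for the order of the tensor factors in which [m] is moved so
   as to follow exactly the factors [l < k], the others keeping their order. *)
Definition permuted_W (m : 'I_n) (x : 'I_n -> K) (s : K) (k : nat) : 'cV[K]_n :=
  \col_j
    if j == m then \prod_(l | l != m) (if (l < k)%N then s - x l + Lam l else s - x l)
    else (\prod_(l | (l != m) && (l < j)%N) (s - x l + Lam l)) *
         (\prod_(l | (l != m) && (j < l)%N) (s - x l)) *
         (if (j < k)%N then s - x m else s - x m + Lam m).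

Lemma permuted_WE m x s : W Lam x s = permuted_W m x s m.
Proof.
apply/colP => j; rewrite !mxE; case: eqVneq => [->|neq_jm].
  rewrite [RHS](bigID (fun l : 'I_n => (l < m)%N)) /=; congr (_ * _).
    rewrite (eq_bigl (fun l : 'I_n => (l != m) && (l < m)%N)); last first.
      by move=> l; rewrite neq_ltn andbC; case: (l < m)%N.
    by apply: eq_bigr => l /andP[_ ->].
  rewrite (eq_bigl (fun l : 'I_n => (l != m) && ~~ (l < m)%N)); last first.
    by move=> l; rewrite -leqNgt; rewrite ltn_neqAle eq_sym.
  by apply: eq_bigr => l /andP[_ /negbTE->].
have E1 (b : pred 'I_n) (F : 'I_n -> K) : ~~ b m ->
    \prod_(l | b l) F l = \prod_(l | (l != m) && b l) F l.
  move=> /negbTE bm; apply: eq_bigl => l.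
  by case: eqVneq => //= ->.
have E2 (b : pred 'I_n) (F : 'I_n -> K) : b m ->
    \prod_(l | b l) F l = F m * \prod_(l | (l != m) && b l) F l.
  by move=> bm; rewrite (bigD1 m) //; under eq_bigl do rewrite andbC.
case: ltngtP => [jm|mj|/val_inj/eqP]; last by rewrite (negbTE neq_jm).
- rewrite (E1 (fun l => l < j)%N) -?leqNgt 1?ltnW // (E2 (fun l => j < l)%N) //.
  by rewrite mulrCA mulrC.
- rewrite (E2 (fun l => l < j)%N) // (E1 (fun l => j < l)%N) -?leqNgt 1?ltnW //.
  by rewrite -mulrA mulrC.
Qed.

(** Entries off [m] and [k] do not distinguish position [k] from [k.+1], and the entries at [m] and
    [k] share the factor [Z]; what remains is a rational identity for the 2 x 2 block. *)
Lemma Rop_permuted_W (m k : 'I_n) x s : k != m -> x m - x k - Lam m != 0 ->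
  Rop Lam m k (x m - x k) *m permuted_W m x s k = permuted_W m x s k.+1.
Proof.
move=> km nz.
have mk : m != k by rewrite eq_sym.
pose Z := \prod_(l | (l != m) && (l < k)%N) (s - x l + Lam l) *
          \prod_(l | (l != m) && (k < l)%N) (s - x l).
have Um (k' : nat) : (k' == k) || (k' == k.+1) ->
    permuted_W m x s k' m 0 = Z * (if (k' == k)%N then s - x k else s - x k + Lam k).
  move=> hk'; rewrite mxE eqxx (bigD1 k) //= mulrC; congr (_ * _); last first.
    by case/orP: hk' => /eqP ->; rewrite ?ltnn ?eqxx // ltnSn gtn_eqF.
  rewrite (bigID (fun l : 'I_n => (l < k)%N)) /=; congr (_ * _).
    apply: eq_big => [l|l /andP[_ lk]].
      by case: (eqVneq l m) => //= _; case: eqVneq => //= ->; rewrite ltnn.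
    by rewrite ifT //; case/orP: hk' => /eqP ->; lia.
  apply: eq_big => [l|l /andP[/andP[_ lnk] lk]].
    case: (eqVneq l m) => //= _; rewrite -leqNgt.
    by rewrite [RHS]ltn_neqAle [k == l :> nat]eq_sym.
  rewrite ifF //; have {lnk}: (l : nat) != k by [].
  by case/orP: hk' => /eqP ->; lia.
have Uk (k' : nat) : permuted_W m x s k' k 0 =
    Z * (if (k < k')%N then s - x m else s - x m + Lam m).
  by rewrite mxE (negbTE km).
apply/colP => j; rewrite mxE.
have [/orP jmk|/norP[jm jk]] := boolP ((j == m) || (j == k)); last first.
  rewrite (bigD1 j) //= big1 ?addr0; last first.
    by move=> l lj; rewrite !mxE !inE (negbTE jm) (negbTE jk) /= eq_sym (negbTE lj) mul0r.
  rewrite !mxE !inE (negbTE jm) (negbTE jk) /= eqxx mul1r.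
  by rewrite ltnS [(j <= k)%N]leq_eqVlt [_ == _ :> nat](negbTE jk).
rewrite (bigD1 m) //= (bigD1 k) //= big1 ?addr0; last first.
  move=> l /andP[lm lk]; rewrite !mxE !inE (negbTE lm) (negbTE lk) andbF.
  by case: (eqVneq j l) jmk => [-> []|]; rewrite ?(negbTE lm) ?(negbTE lk) ?mul0r.
rewrite Um ?eqxx // Uk ltnn !mxE !inE !eqxx orbT !(negbTE km).
case: jmk => /eqP ->; rewrite ?eqxx ?orbT ?(negbTE km) /=.
  by have := Um k.+1; rewrite mxE !eqxx orbT gtn_eqF // => -> //; field.
by rewrite ltnSn -/Z; field.
Qed.

End OffShellBethe.

(** * The qKZ operators on the Bethe vector before the Bethe equation is imposed *)

Section QKZBethe.

Variables (K : fieldType) (n : nat) (Lam : 'I_n -> K).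

(** [V j] is the vector just before the factor of index [j] acts: in the reversed list the smallest
    index stands rightmost. An index outside [P] leaves [V] unchanged. *)
Lemma big_mulmx_rev_enum (P : pred 'I_n) (F : 'I_n -> 'M[K]_n) (V : nat -> 'cV[K]_n) :
    (forall j : 'I_n, V j.+1 = if P j then F j *m V j else V j) ->
  (\big[mulmx/1%:M]_(j <- rev (enum 'I_n) | P j) F j) *m V 0%N = V n.
Proof.
move=> FV; suff gen s : map val s = iota 0 (size s) ->
    (\big[mulmx/1%:M]_(j <- rev s | P j) F j) *m V 0%N = V (size s).
  by rewrite gen size_enum_ord // val_enum_ord.
elim/last_ind: s => [_|s j IH]; first by rewrite big_nil mul1mx.
rewrite map_rcons size_rcons -addn1 iotaD cats1 add0n addn1.
case/rcons_inj=> /IH Vs js; rewrite rev_rcons big_cons -js FV.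
by case: ifP => _; rewrite -?mulmxA Vs js.
Qed.

Lemma permuted_WS (m : 'I_n) x s : permuted_W Lam m x s m.+1 = permuted_W Lam m x s m.
Proof.
have ltS (l : 'I_n) : l != m -> (l < m.+1)%N = (l < m)%N.
  by move=> lm; rewrite ltnS leq_eqVlt (inj_eq val_inj) (negbTE lm).
apply/colP => j; rewrite !mxE; case: eqVneq => [_|/ltS-> //].
by apply: eq_bigr => l /ltS->.
Qed.

Lemma Rop_prod_permuted_W_high (m : 'I_n) x s :
    (forall k, k != m -> x m - x k - Lam m != 0) ->
  (\big[mulmx/1%:M]_(j <- rev (enum 'I_n) | (m < j)%N) Rop Lam m j (x m - x j))
    *m permuted_W Lam m x s m = permuted_W Lam m x s n.
Proof.
move=> nz.
(* With [maxn] the sequence is constant up to index [m], and [permuted_WS] covers the index [m]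
   itself, so that only the factors above [m] act. *)
have := @big_mulmx_rev_enum (fun j => m < j)%N _
  (fun k => permuted_W Lam m x s (maxn k m)).
rewrite max0n (maxn_idPl (ltnW (ltn_ord m))); apply=> j /=.
case: ltngtP => [mj|jm|/val_inj <-]; last by rewrite (maxn_idPl _) ?permuted_WS.
  rewrite !(maxn_idPl _) ?(ltnW mj) // ?(leq_trans (ltnW mj)) //.
  by rewrite Rop_permuted_W //; last apply: nz; rewrite neq_ltn mj orbT.
by rewrite !(maxn_idPr _) // ltnW.
Qed.

Lemma Rop_prod_permuted_W_low (m : 'I_n) x s :
    (forall k, k != m -> x m - x k - Lam m != 0) ->
  (\big[mulmx/1%:M]_(j <- rev (enum 'I_n) | (j < m)%N) Rop Lam m j (x m - x j))
    *m permuted_W Lam m x s 0 = permuted_W Lam m x s m.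
Proof.
move=> nz.
have := @big_mulmx_rev_enum (fun j => j < m)%N _
  (fun k => permuted_W Lam m x s (minn k m)).
rewrite min0n (minn_idPr (ltnW (ltn_ord m))); apply=> j /=.
case: ltngtP => [jm|mj|/val_inj ->]; last by rewrite (minn_idPr (leqnSn _)).
  rewrite !(minn_idPl _) ?(ltnW jm) //.
  by rewrite Rop_permuted_W //; last apply: nz; rewrite neq_ltn jm.
by rewrite !(minn_idPr _) // ltnW // ltnS ltnW.
Qed.

Variables (a kappa : K).

(** The factors above [m] move [m] to the last place. The result, after [kappa_h2], is compared with
    the vector where [m] comes first and [x m] is raised by [a]: the two are proportional in every
    entry but the [m]-th, whose excess is the discrete derivative built from [c]. The factors below
    [m] then act on both. *)
Lemma qKZ_W (m : 'I_n) x s :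
    (forall k, k != m -> x m - x k - Lam m != 0) ->
    (forall k, k != m -> x m - x k - Lam m + a != 0) ->
    (forall l, s - x l + a != 0) ->
    s - x m + Lam m != 0 -> s - x m - a + Lam m != 0 ->
  let c t := (\prod_l (t - x l)) / (t - x m - a + Lam m) in
  qKZ Lam a kappa m x *m W Lam x s =
    ((s - x m) / (s - x m - a + Lam m)) *: W Lam (shift x m a) s
    + (Phi Lam a kappa x s * c (s + a) - c s) *:
      ((\big[mulmx/1%:M]_(j <- rev (enum 'I_n) | (j < m)%N)
         Rop Lam m j (x m - x j + a)) *m delta_mx m 0).
Proof.
move=> nzR nzRa nza nzL nzLa c; rewrite /qKZ -!mulmxA.
rewrite (permuted_WE Lam m x) Rop_prod_permuted_W_high //.
set G := \big[mulmx/1%:M]_(j <- _ | _) _.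
have xm : shift x m a m = x m + a by rewrite /shift eqxx.
have xk k : k != m -> shift x m a k = x k by rewrite /shift => /negbTE->.
(* The summand [a] in the arguments of the lower factors is exactly the shift of [x m]. *)
have -> : W Lam (shift x m a) s = G *m permuted_W Lam m (shift x m a) s 0.
  rewrite (permuted_WE Lam m) -Rop_prod_permuted_W_low; last first.
    move=> k km; rewrite xm xk //; have := nzRa k km.
    by congr (_ != 0); ring.
  congr (_ *m _); apply: eq_bigr => j jm; congr Rop.
  rewrite xm xk; first by ring.
  by rewrite neq_ltn jm.
rewrite 2!scalemxAr -mulmxDr; congr (_ *m _).
apply/colP => j; rewrite /kappa_h2 mul_diag_mx !mxE.
have [_|jm] := eqVneq j m; last first.
  rewrite ltn_ord /= mul1r mulr0 addr0 xm.
  have E (b : pred 'I_n) (f : K -> 'I_n -> K) :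
      \prod_(l | (l != m) && b l) f (shift x m a l) l = \prod_(l | (l != m) && b l) f (x l) l.
    by apply: eq_bigr => l /andP[/xk->].
  rewrite (E (fun l => l < j)%N (fun t l => s - t + Lam l)).
  rewrite (E (fun l => j < l)%N (fun t l => s - t)).
  by field.
have -> : \prod_(l < n | l != m) (if (l < 0)%N then s - shift x m a l + Lam l
     else s - shift x m a l) = \prod_(l < n | l != m) (s - x l).
  by apply: eq_bigr => l /xk->.
have -> : \prod_(l < n | l != m) (if (l < n)%N then s - x l + Lam l else s - x l)
   = \prod_(l < n | l != m) (s - x l + Lam l).
  by apply: eq_bigr => l _; rewrite ltn_ord.
have cS : \prod_l (s - x l) = (s - x m) * \prod_(l | l != m) (s - x l) by rewrite (bigD1 m).
have cL : \prod_l (s - x l + Lam l) =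
    (s - x m + Lam m) * \prod_(l | l != m) (s - x l + Lam l) by rewrite (bigD1 m).
have ca : \prod_l (s + a - x l) = \prod_l (s - x l + a).
  by apply: eq_bigr => i _; rewrite addrAC.
have nzP : \prod_l (s - x l + a) != 0 by apply/prodf_neq0.
have nzL' : s + a - x m - a + Lam m != 0.
  by have := nzL; congr (_ != 0); ring.
rewrite eqxx mulr1 /c /Phi big_split /= prodfV cS cL ca; field.
by rewrite nzL' nzP nzLa.
Qed.

End QKZBethe.

(** * Eigenvectors of the p-curvature *)

Section HpPolynomial.

Variables (K : fieldType) (p : nat) (a : K).
Hypothesis charKp : p \in [pchar K].

Let p_gt0 : (0 < p)%N := prime_gt0 (pcharf_prime charKp).

Let p_gt1 : (1 < p)%N := prime_gt1 (pcharf_prime charKp).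

Lemma mulrn_pchar_eq0 (u : K) : u *+ p = 0.
Proof. by rewrite -mulr_natr (pcharf0 charKp) mulr0. Qed.

Lemma h_pD u v : h_p p a (u + v) = h_p p a u + h_p p a v.
Proof.
rewrite /h_p -!(pFrobenius_autE charKp) pFrobenius_autD_comm; last exact: mulrC.
by ring.
Qed.

Lemma h_pN u : h_p p a (- u) = - h_p p a u.
Proof. by rewrite /h_p -!(pFrobenius_autE charKp) pFrobenius_autN; ring. Qed.

Lemma h_pMn j : h_p p a (a *+ j) = 0.
Proof.
rewrite /h_p -!(pFrobenius_autE charKp) pFrobenius_autMn pFrobenius_autE.
by rewrite mulrnAr -exprSr prednK // subrr.
Qed.

(** For [a != 0] the [p] elements [- (a *+ j)] are distinct roots of a monic polynomial of degree
    [p]. For [a = 0] both sides are [u ^+ p]. *)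
Lemma h_p_prod u : h_p p a u = \prod_(j < p) (u + a *+ j).
Proof.
have [a0|a_neq0] := eqVneq a 0.
  rewrite /h_p a0 expr0n -subn1 subn_eq0 leqNgt p_gt1 mul0r subr0.
  rewrite (eq_bigr (fun=> u)) ?prodr_const ?card_ord // => j _.
    by rewrite mul0rn addr0.
pose f : {poly K} := 'X^p - (a ^+ p.-1) *: 'X.
have hf v : f.[v] = h_p p a v by rewrite !hornerE.
have size_f : size f = p.+1.
  rewrite size_polyDl ?size_polyXn // size_polyN (leq_ltn_trans (size_scale_leq _ _)) //.
  by rewrite size_polyX ltnS.
have f_monic : f \is monic.
  rewrite monicE lead_coefDl ?lead_coefXn // size_polyXn size_polyN.
  rewrite (leq_ltn_trans (size_scale_leq _ _)) //.
  by rewrite size_polyX ltnS.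
pose rs := [seq - (a *+ (j : nat)) | j : 'I_p].
have : f = lead_coef f *: \prod_(z <- rs) ('X - z%:P).
  apply: all_roots_prod_XsubC.
  - by rewrite size_f size_map size_enum_ord.
  - apply/allP => _ /mapP[j _ ->]; apply/rootP.
    by rewrite hf h_pN h_pMn oppr0.
  - rewrite uniq_rootsE map_inj_uniq ?enum_uniq // => i j /oppr_inj.
    move/eqP; rewrite -![a *+ _]mulr_natr (inj_eq (mulfI a_neq0)) => /eqP eq_ij.
    apply: val_inj; wlog lij : i j eq_ij / (i <= j)%N.
      by move=> H; case/orP: (leq_total i j) => /H-> //.
    have : (p %| j - i)%N by rewrite (dvdn_pcharf charKp) natrB // eq_ij subrr.
    move/eqP; rewrite modn_small; last by rewrite (leq_ltn_trans (leq_subr _ _)).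
    by move/eqP; rewrite subn_eq0 => lji; apply/eqP; rewrite eqn_leq lij.
rewrite (monicP f_monic) scale1r => /(congr1 (horner^~ u)).
rewrite hf => ->; rewrite horner_prod big_map big_enum; apply: eq_bigr => j _.
by rewrite !hornerE opprK.
Qed.

Lemma h_p_prodB u : \prod_(j < p) (u - a *+ j) = h_p p a u.
Proof.
(* [rev_ord] sends [j] to [p - j.+1]; the translation by [a] absorbs the offset. *)
have <- : h_p p a (u + a) = h_p p a u by rewrite h_pD (h_pMn 1) addr0.
rewrite h_p_prod (reindex_inj rev_ord_inj) /=; apply: eq_bigr => j _.
rewrite mulrnBr // mulrn_pchar_eq0 mulrS; ring.
Qed.

End HpPolynomial.

Section Eigenvector.

Variables (K : fieldType) (p n : nat) (Lam : 'I_n -> K) (a kappa : K).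
Hypothesis charKp : p \in [pchar K].

Let p_gt0 : (0 < p)%N := prime_gt0 (pcharf_prime charKp).

(** Letting [k] range over all naturals makes stability under shifts by multiples of [a] immediate;
    since [a *+ p = 0], it amounts to [k < p]. *)
Definition off_divisors (x : 'I_n -> K) s :=
  forall i k, (s - x i + a *+ k != 0) && (s - x i + Lam i + a *+ k != 0).

Definition off_collisions (m : 'I_n) (x : 'I_n -> K) :=
  forall i k, i != m -> x m - x i - Lam m + a *+ k != 0.

(** When [s] solves the Bethe equation, [K_m(x)] sends [J(s, x)] to this multiple of
    [J(s, x + a f_m)]. *)
Definition qKZ_factor (m : 'I_n) (x : 'I_n -> K) (s : K) :=
  (s - x m) / (s - x m - a + Lam m).

(** Negative multiples of [a] become natural ones, to which [off_divisors] applies. *)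
Lemma mulrn_pred_pchar (u : K) k : u *+ (p.-1 * k) = - (u *+ k).
Proof.
apply/eqP; rewrite -addr_eq0 -mulrnDr -mulSnr prednK //.
by rewrite mulnC mulrnA mulrn_pchar_eq0.
Qed.

Lemma shiftS (m : 'I_n) (x : 'I_n -> K) k :
  shift (shift x m (a *+ k)) m a = shift x m (a *+ k.+1).
Proof.
apply: functional_extensionality => i; rewrite /shift; case: eqP => // _.
by rewrite mulrSr addrA.
Qed.

Lemma shift_period (m : 'I_n) (x : 'I_n -> K) : shift x m (a *+ p) = x.
Proof.
apply: functional_extensionality => i; rewrite /shift mulrn_pchar_eq0 // addr0.
by case: eqP.
Qed.

Lemma off_divisors_shift (m : 'I_n) x s k :
  off_divisors x s -> off_divisors (shift x m (a *+ k)) s.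
Proof.
move=> offx i j; rewrite /shift; case: (_ == m); last exact: offx.
have := offx i (j + p.-1 * k)%N; rewrite mulrnDr mulrn_pred_pchar.
by congr (_ && _); congr (_ != 0); ring.
Qed.

Lemma off_collisions_shift (m : 'I_n) x k :
  off_collisions m x -> off_collisions m (shift x m (a *+ k)).
Proof.
move=> offx i j im; rewrite /shift eqxx (negbTE im).
have := offx i (k + j)%N im; rewrite mulrnDr.
by congr (_ != 0); ring.
Qed.

Lemma off_divisors_subr m x s : off_divisors x s -> s - x m - a + Lam m != 0.
Proof.
move=> /(_ m (p.-1 * 1)%N)/andP[_]; rewrite mulrn_pred_pchar mulr1n.
by congr (_ != 0); ring.
Qed.

Lemma off_divisorsD x s k : off_divisors x s -> off_divisors x (s + a *+ k).
Proof.
move=> offx i j; have := offx i (k + j)%N; rewrite mulrnDr.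
by congr (_ && _); congr (_ != 0); ring.
Qed.

Lemma qKZ_factor_neq0 m x s : off_divisors x s -> qKZ_factor m x s != 0.
Proof.
move=> offx; rewrite mulf_neq0 ?invr_neq0 ?off_divisors_subr //.
by have /andP[] := offx m 0%N; rewrite mulr0n addr0.
Qed.

(** Only the [m]-th factor of [Phi] feels the shift, and it changes by the quotient of [qKZ_factor]
    at [s + a] and at [s]. Along [s, s + a, ...] these quotients telescope. *)
Lemma Phi_shift m x s : off_divisors x s ->
  Phi Lam a kappa x s * qKZ_factor m x (s + a) =
  qKZ_factor m x s * Phi Lam a kappa (shift x m a) s.
Proof.
move=> offx; have nzLa := off_divisors_subr m offx.
have /andP[] := offx m 0%N; rewrite mulr0n !addr0 => nz nzL.
have /andP[] := offx m 1%N; rewrite mulr1n => nza _.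
rewrite /Phi /qKZ_factor (bigD1 m) //= [X in _ = _ * (_ * X)](bigD1 m) //=.
have -> : \prod_(i < n | i != m)
    ((s - shift x m a i + Lam i) / (s - shift x m a i + a)) =
  \prod_(i < n | i != m) ((s - x i + Lam i) / (s - x i + a)).
  by apply: eq_bigr => i /negbTE im; rewrite /shift im.
have -> : shift x m a m = x m + a by rewrite /shift eqxx.
have nz1 : s + a - x m - a + Lam m != 0 by have := nzL; congr (_ != 0); ring.
have nz3 : s - (x m + a) + a != 0 by have := nz; congr (_ != 0); ring.
by field; rewrite nz1 nz3 nza nzLa.
Qed.

Lemma prod_Phi_shift m x s d : off_divisors x s ->
  (\prod_(j < d) Phi Lam a kappa x (s + a *+ j)) * qKZ_factor m x (s + a *+ d) =
  qKZ_factor m x s * \prod_(j < d) Phi Lam a kappa (shift x m a) (s + a *+ j).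
Proof.
move=> offx; elim: d => [|d IH]; first by rewrite !big_ord0 addr0 mul1r mulr1.
rewrite !big_ord_recr /= -mulrA mulrSr addrA Phi_shift; last exact: off_divisorsD.
by rewrite mulrA IH mulrA.
Qed.

(** Over a full period [qKZ_factor] returns to its value at [s], so shifting [x] preserves the Bethe
    equation. *)
Lemma prod_Phi_shift_period m x s : off_divisors x s ->
  \prod_(j < p) Phi Lam a kappa (shift x m a) (s + a *+ j) =
  \prod_(j < p) Phi Lam a kappa x (s + a *+ j).
Proof.
move=> offx; apply: (mulfI (qKZ_factor_neq0 m offx)).
by rewrite -prod_Phi_shift // mulrn_pchar_eq0 // addr0 mulrC.
Qed.

Lemma prod_Phi_shift_pow m x s k : off_divisors x s ->
  \prod_(j < p) Phi Lam a kappa (shift x m (a *+ k)) (s + a *+ j) =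
  \prod_(j < p) Phi Lam a kappa x (s + a *+ j).
Proof.
move=> offx; elim: k => [|k IH].
  by have -> : shift x m (a *+ 0) = x by
    apply: functional_extensionality => i; rewrite /shift addr0; case: eqP.
by rewrite -shiftS prod_Phi_shift_period ?IH //; apply: off_divisors_shift.
Qed.

(* The defect [Phi c(s + a) - c(s)] of the off-shell identity telescopes along
   [s, s + a, ..., s + (p - 1) a], and its total vanishes by the Bethe equation. *)
Lemma qKZ_bethe_vector m x s :
    off_divisors x s -> off_collisions m x ->
    \prod_(j < p) Phi Lam a kappa x (s + a *+ j) = 1 ->
  qKZ Lam a kappa m x *m bethe_vector p Lam a kappa x s =
  qKZ_factor m x s *: bethe_vector p Lam a kappa (shift x m a) s.
Proof.
move=> offx offm bae.
pose c t := (\prod_l (t - x l)) / (t - x m - a + Lam m).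
set Pi := fun d => \prod_(j < d) Phi Lam a kappa x (s + a *+ j).
pose g := (\big[mulmx/1%:M]_(j <- rev (enum 'I_n) | (j < m)%N)
         Rop Lam m j (x m - x j + a)) *m delta_mx m 0 : 'cV_n.
rewrite /bethe_vector mulmx_sumr scaler_sumr.
have tele : \sum_(d < p) (Pi d.+1 * c (s + a *+ d.+1) - Pi d * c (s + a *+ d)) = 0.
  rewrite -(big_mkord xpredT (fun d => Pi d.+1 * c (s + a *+ d.+1) - Pi d * c (s + a *+ d))).
  rewrite (telescope_sumr (fun d => Pi d * c (s + a *+ d))) // mulrn_pchar_eq0 //.
  by rewrite /Pi bae big_ord0 mulr0n subrr.
rewrite -[RHS]addr0 -[X in _ + X](scale0r g) -tele scaler_suml -big_split /=.
apply: eq_bigr => d _; have offd := off_divisorsD d offx.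
rewrite -scalemxAr qKZ_W; first last.
- exact: off_divisors_subr.
- by have /andP[_] := offd m 0%N; rewrite addr0.
- by move=> l; have /andP[] := offd l 1%N.
- by move=> k km; have := offm k 1%N km.
- by move=> k km; have := offm k 0%N km; rewrite addr0.
rewrite -/g scalerDr !scalerA -/(qKZ_factor m x _) -prod_Phi_shift //.
congr (_ + _ *: _).
by rewrite mulrBr mulrA /Pi big_ord_recr /= mulrSr addrA.
Qed.

Lemma qKZ_iter_bethe_vector m x s q :
    off_divisors x s -> off_collisions m x ->
    \prod_(j < p) Phi Lam a kappa x (s + a *+ j) = 1 ->
  (\big[mulmx/1%:M]_(k <- rev (iota 0 q)) qKZ Lam a kappa m (shift x m (a *+ k)))
    *m bethe_vector p Lam a kappa x s =
  (\prod_(k < q) qKZ_factor m (shift x m (a *+ k)) s)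
    *: bethe_vector p Lam a kappa (shift x m (a *+ q)) s.
Proof.
move=> offx offm bae; elim: q => [|q IH].
  rewrite big_nil big_ord0 mul1mx scale1r; congr (bethe_vector _ _ _ _ _ _).
  by apply: functional_extensionality => i; rewrite /shift addr0; case: eqP.
have -> : iota 0 q.+1 = rcons (iota 0 q) q by rewrite -addn1 iotaD cats1.
rewrite rev_rcons big_cons -mulmxA IH.
rewrite -scalemxAr qKZ_bethe_vector.
- by rewrite shiftS scalerA big_ord_recr.
- exact: off_divisors_shift.
- exact: off_collisions_shift.
- by rewrite prod_Phi_shift_pow.
Qed.

(** After [p] steps [x] is back at its starting point, so the vectors on both sides coincide; the
    scalars collected on the way run through full periods and multiply to values of [h_p]. *)
Lemma p_curvature_bethe_vector m x s :
    off_divisors x s -> off_collisions m x ->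
    \prod_(j < p) Phi Lam a kappa x (s + a *+ j) = 1 ->
  p_curvature p Lam a kappa m x *m bethe_vector p Lam a kappa x s =
  (h_p p a (s - x m) / h_p p a (s - x m + Lam m)) *: bethe_vector p Lam a kappa x s.
Proof.
move=> offx offm bae; rewrite qKZ_iter_bethe_vector // shift_period; congr (_ *: _).
rewrite big_split prodfV /=; congr (_ / _).
  rewrite -h_p_prodB //; apply: eq_bigr => k _.
  by rewrite /shift eqxx opprD addrA.
have <- : h_p p a (s - x m - a + Lam m) = h_p p a (s - x m + Lam m).
  by rewrite addrAC h_pD // h_pN // (h_pMn a charKp 1) subr0.
rewrite -h_p_prodB //; apply: eq_bigr => k _.
by rewrite /shift eqxx; ring.
Qed.

Lemma prod_PhiE x s : \prod_(j < p) Phi Lam a kappa x (s + a *+ j) =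
  kappa ^+ p * \prod_(i < n) (h_p p a (s - x i + Lam i) / h_p p a (s - x i)).
Proof.
rewrite /Phi big_split /= prodr_const card_ord; congr (_ * _).
rewrite exchange_big /=; apply: eq_bigr => i _.
rewrite big_split prodfV /=; congr (_ / _).
  by rewrite h_p_prod //; apply: eq_bigr => j _; ring.
have <- : h_p p a (s - x i + a) = h_p p a (s - x i).
  by rewrite h_pD // (h_pMn a charKp 1) addr0.
by rewrite h_p_prod //; apply: eq_bigr => j _; ring.
Qed.

End Eigenvector.

Section Eigenbasis.

Variables (K : fieldType) (n : nat) (M : 'M[K]_n) (v : 'I_n -> 'cV[K]_n) (mu : 'I_n -> K).

(** The product of the [M - mu j] over [j != i0], applied to a linear relation, leaves only the
    [i0]-th term, with a nonzero multiplier. *)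
Lemma eigenvectors_basis :
    (forall i, M *m v i = mu i *: v i) -> (forall i, v i != 0) -> injective mu ->
  basis_of {:'cV[K]_n} [seq v i | i <- enum 'I_n].
Proof.
move=> Mv v_neq0 inj_mu; rewrite basisEfree subvf andTb.
pose X : n.-tuple 'cV[K]_n := [tuple v i | i < n].
rewrite size_map size_enum_ord dimvf /dim /= muln1 leqnn andbT.
apply/(@freeP _ _ _ X) => k kv0 i0.
have {}kv0 : \sum_i k i *: v i = 0.
  by rewrite -[RHS]kv0; apply: eq_bigr => i _; rewrite -tnth_nth tnth_mktuple.
have kill (s : seq 'I_n) : \sum_i (k i * \prod_(j <- s) (mu i - mu j)) *: v i = 0.
  elim: s => [|j s IH].
    by under eq_bigr do rewrite big_nil mulr1.
  rewrite (eq_bigr (fun i => (M - (mu j)%:M) *m ((k i * \prod_(l <- s) (mu i - mu l)) *: v i))).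
    by rewrite -mulmx_sumr IH mulmx0.
  move=> i _; rewrite -scalemxAr mulmxBl Mv mul_scalar_mx -scalerBl scalerA big_cons.
  by rewrite [X in _ * X]mulrC mulrA.
have := kill [seq j <- enum 'I_n | j != i0].
rewrite (bigD1 i0) //= [X in _ + X]big1 ?addr0; last first.
  move=> i i_i0; apply/eqP; rewrite scaler_eq0 mulf_eq0 prodf_seq_eq0.
  apply/orP; left; apply/orP; right; apply/hasP; exists i; last by rewrite /= subrr.
  by rewrite mem_filter i_i0 mem_enum.
move/eqP; rewrite scaler_eq0 (negbTE (v_neq0 i0)) orbF mulf_eq0 => /orP[/eqP //|].
rewrite prodf_seq_eq0 => /hasP[j]; rewrite mem_filter => /andP[ji0 _] /=.
by rewrite subr_eq0 (inj_eq inj_mu) eq_sym (negbTE ji0).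
Qed.

End Eigenbasis.

(** * Branches and their specializations *)

Lemma horner_addr_taylor2 (R : comNzRingType) (f : {poly R}) x h :
  exists q, f.[x + h] = f.[x] + f^`().[x] * h + q * h ^+ 2.
Proof.
elim/poly_ind: f => [|f c [q IH]]; first by exists 0; rewrite deriv0 !horner0; ring.
exists (q * (x + h) + f^`().[x]).
rewrite !hornerMXaddC IH derivMXaddC hornerD hornerMX; ring.
Qed.

Lemma dvdp_horner_sub (K : fieldType) (f : {poly {poly K}}) u v :
  u - v %| f.[u] - f.[v].
Proof.
have [q] := horner_addr_taylor2 f v (u - v); rewrite addrC subrK => ->.
have -> : f.[v] + f^`().[v] * (u - v) + q * (u - v) ^+ 2 - f.[v] =
  (f^`().[v] + q * (u - v)) * (u - v) by ring.
exact: dvdp_mulIr.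
Qed.

(** * Hensel lifting through truncations of power series *)

Section Hensel.

Variables (K : fieldType) (f : {poly {poly K}}) (y : K).
Hypothesis root_y : 'X %| f.[y%:P].
Hypothesis simple_y : (f^`().[y%:P]).[0] != 0.

Lemma truncS (g : nat -> K) N : trunc g N.+1 = trunc g N + g N *: 'X^N.
Proof. by rewrite /trunc !poly_def big_ord_recr. Qed.

Lemma trunc_horner0 (g : nat -> K) N : (trunc g N.+1).[0] = g 0%N.
Proof. by rewrite horner_coef0 coef_poly. Qed.

Lemma deriv_trunc_horner0 (g : nat -> K) N : g 0%N = y ->
  (f^`().[trunc g N.+1]).[0] = (f^`().[y%:P]).[0].
Proof.
move=> g0; apply/eqP; rewrite -subr_eq0 -hornerN -hornerD -rootE -dvdp_XsubCl subr0.
apply: dvdp_trans (dvdp_horner_sub _ _ _).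
by rewrite -['X]subr0 dvdp_XsubCl rootE !hornerE trunc_horner0 g0 subrr.
Qed.

(** Modulo ['X^(N.+1)] the new coefficient [g N] enters linearly, its slope being the nonzero
    constant term of the derivative at [y]: the quadratic Taylor term has order at least [2 N],
    hence [N + 1] since [N > 0]. Existence and uniqueness both follow from this one equation. *)
Lemma hensel_step (g : nat -> K) N : (0 < N)%N -> g 0%N = y -> 'X^N %| f.[trunc g N] ->
  ('X^(N.+1) %| f.[trunc g N.+1]) = ((f.[trunc g N])`_N + g N * (f^`().[y%:P]).[0] == 0).
Proof.
case: N => // N _ g0 /dvdpP[r fr].
rewrite truncS; have [q ->] := horner_addr_taylor2 f (trunc g N.+1) (g N.+1 *: 'X^(N.+1)).
rewrite fr coefMXn ltnn subnn -horner_coef0.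
rewrite -(deriv_trunc_horner0 N g0).
set d := f^`().[_].
have -> : r * 'X^(N.+1) + d * (g N.+1 *: 'X^(N.+1)) + q * (g N.+1 *: 'X^(N.+1)) ^+ 2 =
   (r + g N.+1 *: d + (q * (g N.+1 ^+ 2 *: 'X^N)) * 'X) * 'X^(N.+1).
  by rewrite exprSr -!mul_polyC rmorphXn /=; ring.
rewrite [in LHS]exprS dvdp_mul2r ?expf_neq0 ?polyX_eq0 //.
rewrite dvdp_addl ?dvdp_mull //.
by rewrite -['X]subr0 dvdp_XsubCl rootE !hornerE.
Qed.

(** The recursion runs over truncations, since each new coefficient depends on all the earlier
    ones. *)
Fixpoint hensel_trunc N : {poly K} :=
  if N is N'.+1 then
    hensel_trunc N' +
      (if N' == 0%N then y
       else - (f.[hensel_trunc N'])`_N' / (f^`().[y%:P]).[0]) *: 'X^N'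
  else 0.

Definition hensel_series N : K :=
  if N == 0%N then y
  else - (f.[hensel_trunc N])`_N / (f^`().[y%:P]).[0].

Lemma trunc_hensel_series N : trunc hensel_series N = hensel_trunc N.
Proof.
elim: N => [|N IH]; first by rewrite /trunc poly_def big_ord0.
by rewrite truncS IH.
Qed.

Lemma trunc1 (g : nat -> K) : g 0%N = y -> trunc g 1 = y%:P.
Proof. by move=> g0; rewrite truncS g0 /trunc poly_def big_ord0 add0r alg_polyC. Qed.

Lemma hensel_seriesP N : 'X^N %| f.[trunc hensel_series N].
Proof.
elim: N => [|[_|N IH]]; first by rewrite dvd1p.
  by rewrite trunc1.
rewrite hensel_step // {2}/hensel_series /= trunc_hensel_series.
by rewrite mulfVK // subrr.
Qed.

Lemma hensel_unique (g : nat -> K) : g 0%N = y ->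
  (forall N, 'X^N %| f.[trunc g N]) -> g =1 hensel_series.
Proof.
move=> g0 gP N; have gN k : (0 < k)%N -> g k = - (f.[trunc g k])`_k / (f^`().[y%:P]).[0].
  move=> k0; have := gP k.+1; rewrite hensel_step // addrC addr_eq0 => /eqP <-.
  by rewrite mulfK.
suff tg k : trunc g k = hensel_trunc k.
  by rewrite /hensel_series; case: eqP => [->//|/eqP]; rewrite -lt0n -tg => /gN.
elim: k => [|k IH]; first by rewrite /trunc poly_def big_ord0.
rewrite truncS /= IH; case: eqP => [->|/eqP]; first by rewrite g0.
by rewrite -lt0n => /gN ->; rewrite IH.
Qed.

End Hensel.

(** * Factorization modulo a power of eps *)

Section VandermondeDivisibility.

Variables (K : fieldType) (M : nat) (rho : 'I_M -> {poly K}).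
Hypothesis inj_rho0 : injective (fun k => (rho k).[0]).

(** The coefficients of [D] are recovered from its values at the [rho k] through a Vandermonde
    matrix, whose determinant is prime to ['X] because the nodes have distinct constant terms. *)
Lemma dvdp_coef_of_dvdp_horner (D : {poly {poly K}}) N : (size D <= M)%N ->
  (forall k, 'X^N %| D.[rho k]) -> forall k, 'X^N %| D`_k.
Proof.
move=> szD divD k; have [kM|Mk] := ltnP k M; last first.
  by rewrite (leq_sizeP _ _ szD) ?dvdp0.
pose V := Vandermonde M (\row_j rho j).
pose c := \row_(i < M) D`_i.
have cV : c *m V = \row_j D.[rho j].
  apply/rowP => j; rewrite !mxE (horner_coef_wide _ szD).
  by apply: eq_bigr => i _; rewrite !mxE.
have detV0 : (\det V).[0] != 0.
  rewrite det_Vandermonde horner_prod; apply/prodf_neq0 => i _.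
  rewrite horner_prod; apply/prodf_neq0 => j ij.
  rewrite !mxE hornerD hornerN subr_eq0 (inj_eq inj_rho0).
  by rewrite neq_ltn ij orbT.
have copr : coprimep ('X^N) (\det V).
  by rewrite coprimep_expl // coprimep_sym -['X]subr0 coprimep_XsubC rootE.
rewrite -(Gauss_dvdpr _ copr).
have := congr1 (fun A => (A *m \adj V) 0 (Ordinal kM)) cV.
rewrite -mulmxA mul_mx_adj mul_mx_scalar !mxE /= => ->.
by elim/big_ind: _ => [|u v|j _]; [exact: dvdp0|exact: dvdp_add|rewrite !mxE dvdp_mulr].
Qed.

(** Both terms have coefficient [w] in degree [M], so their difference has degree below [M] and is
    controlled by its values at the [M] nodes. *)
Lemma dvdp_coef_split (P Q : {poly {poly K}}) (w : {poly K}) N :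
    P \is monic -> Q \is monic -> size P = M.+1 -> size Q = M.+1 ->
    (forall k, 'X^N %| (P - (1 - w) *: Q).[rho k]) ->
  forall k, 'X^N %| (w *: \prod_i ('X - (rho i)%:P) - (P - (1 - w) *: Q))`_k.
Proof.
move=> monP monQ szP szQ root_rho; set R := \prod_i _.
have monR : R \is monic by apply: monic_prod_XsubC.
have szR : size R = M.+1.
  by rewrite /R size_prod_XsubC /index_enum -enumT size_enum_ord.
apply: dvdp_coef_of_dvdp_horner => [|k].
  apply/leq_sizeP => j; rewrite leq_eqVlt => /orP[/eqP<-|Mj].
    have lc (S : {poly {poly K}}) : S \is monic -> size S = M.+1 -> S`_M = 1.
      by move=> /monicP <- sz; rewrite lead_coefE sz.
    by rewrite !coefB !coefZ !lc //; ring.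
  have lc (S : {poly {poly K}}) : size S = M.+1 -> S`_j = 0.
    by move=> sz; rewrite nth_default ?sz.
  by rewrite !coefB !coefZ !lc //; ring.
rewrite hornerD hornerN dvdp_add ?dvdpNr // hornerZ horner_prod (bigD1 k) //=.
by rewrite hornerXsubC subrr mul0r mulr0 dvdp0.
Qed.

End VandermondeDivisibility.

Section SymmetricCongruence.

Variable K : fieldType.
Implicit Types d u v : {poly K}.

Lemma dvdp_subM d u1 v1 u2 v2 :
  d %| u1 - v1 -> d %| u2 - v2 -> d %| u1 * u2 - v1 * v2.
Proof.
move=> d1 d2; have -> : u1 * u2 - v1 * v2 = (u1 - v1) * u2 + v1 * (u2 - v2) by ring.
by apply: dvdp_add; [exact: dvdp_mulr|exact: dvdp_mull].
Qed.

Lemma dvdp_subX d u v k : d %| u - v -> d %| u ^+ k - v ^+ k.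
Proof.
move=> duv; elim: k => [|k IH]; first by rewrite subrr dvdp0.
by rewrite !exprS dvdp_subM.
Qed.

Lemma dvdp_sub_prod d (I : finType) (u v : I -> {poly K}) :
  (forall i, d %| u i - v i) -> d %| \prod_i u i - \prod_i v i.
Proof.
move=> duv; elim/big_rec2: _ => [|i x y _ IH]; first by rewrite subrr dvdp0.
exact: dvdp_subM.
Qed.

Lemma dvdp_sub_sum_seq d (I : eqType) (s : seq I) (u v : I -> {poly K}) :
  {in s, forall i, d %| u i - v i} -> d %| \sum_(i <- s) u i - \sum_(i <- s) v i.
Proof.
move=> duv; rewrite -sumrB big_seq.
by elim/big_ind: _ => [|x y|i /duv]; [exact: dvdp0|exact: dvdp_add|].
Qed.

(* Clearing the leading coefficient [w] in the fundamental theorem of symmetric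
   polynomials: [w ^+ D * H(rho)] is a polynomial [h] in the coefficients of
   [F = w * prod (X - rho_i)], and this persists modulo any [d]. *)
Lemma symmetric_eval_congr M (H : {mpoly {poly K}[M]}) (w : {poly K})
    (F : {poly {poly K}}) : H \is symmetric ->
  exists D h, forall d (rho : 'I_M -> {poly K}),
    (forall k, d %| (w *: \prod_i ('X - (rho i)%:P) - F)`_k) ->
    d %| w ^+ D * H.@[rho] - h.
Proof.
move=> symH; have [t [tH _]] := sym_fundamental symH.
(* By Vieta [c i] is congruent to [w] times the elementary symmetric polynomial of degree [i.+1] in
   the [rho]. *)
pose c (i : 'I_M) := (-1) ^+ i.+1 * F`_(M - i.+1).
(* [msize t] exceeds the degree of each monomial of [t], so every elementary symmetric factor can
   receive its own [w]. *)
exists (msize t).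
exists (\sum_(m <- msupp t) t@_m * (w ^+ (msize t - mdeg m) * \prod_i c i ^+ m i)).
move=> d rho dF; rewrite -tH comp_mpoly_meval mevalE mulr_sumr.
apply: dvdp_sub_sum_seq => m /msize_mdeg_lt ltm.
rewrite mulrCA; apply: dvdp_subM; first by rewrite subrr dvdp0.
rewrite -{1}(subnK (ltnW ltm)) exprD -mulrA.
apply: dvdp_subM; first by rewrite subrr dvdp0.
rewrite mdegE expr_sum -big_split /=; apply: dvdp_sub_prod => i.
rewrite -exprMn; apply: dvdp_subX.
rewrite tnth_mktuple /c.
have vieta : (\prod_i ('X - (rho i)%:P))`_(M - i.+1) =
    (-1) ^+ i.+1 * (mesym M {poly K} i.+1).@[rho].
  have := mroots_coeff (mktuple rho) (lift ord0 i); rewrite lift0 big_map big_enum => ->.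
  by congr (_ * _); apply: meval_eq => j; rewrite tnth_mktuple.
have -> : (mesym M {poly K} i.+1).@[rho] =
    (-1) ^+ i.+1 * (\prod_i ('X - (rho i)%:P))`_(M - i.+1).
  by rewrite vieta mulrA -exprMn mulrNN mulr1 expr1n mul1r.
rewrite mulrCA -mulrBr dvdp_mull //.
by have := dF (M - i.+1)%N; rewrite coefB coefZ.
Qed.

End SymmetricCongruence.

Lemma msym_XU (n : nat) (R : nzRingType) (s : 'S_n) (i : 'I_n) :
  msym s 'X_i = 'X_(s i) :> {mpoly R[n]}.
Proof.
rewrite msymX; congr 'X_[_]; apply/mnmP => j; rewrite !mnmE.
by rewrite -(inj_eq (@perm_inj _ s)) permKV.
Qed.

(** * Existence of specializations *)

Section LyingOver.

Variables (K : closedFieldType) (n M : nat) (sigma : 'I_n -> nat -> K) (eps0 : K).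

Definition rename (rho : 'I_n -> 'I_M) (G : {mpoly {poly K}[n]}) : {mpoly {poly K}[M]} :=
  G \mPo [tuple 'X_(rho i) | i < n].

Lemma meval_rename rho G v : (rename rho G).@[v] = G.@[fun i => v (rho i)].
Proof.
rewrite /rename comp_mpoly_meval; apply: meval_eq => i.
by rewrite tnth_mktuple mevalXU.
Qed.

Lemma msym_rename (s : 'S_M) rho G : msym s (rename rho G) = rename (s \o rho) G.
Proof.
rewrite /rename !comp_mpolyE raddf_sum /=; apply: eq_bigr => m _.
rewrite msymZ rmorph_prod; congr (_ *: _); apply: eq_bigr => i _.
by rewrite rmorphXn /= !tnth_mktuple msym_XU.
Qed.

(** An analogue of a norm: permuting the [M] roots permutes the maps [rho], which makes the product
    symmetric, and one of its factors takes [G] at the branches themselves. *)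
Definition norm_mpoly (G : {mpoly {poly K}[n]}) : {mpoly {poly K}[M]} :=
  \prod_(rho : {ffun 'I_n -> 'I_M}) rename rho G.

Lemma norm_mpoly_sym G : norm_mpoly G \is symmetric.
Proof.
apply/issymP => s; rewrite /norm_mpoly rmorph_prod /=.
pose h (rho : {ffun 'I_n -> 'I_M}) := [ffun i => s (rho i)].
have inj_h : injective h.
  move=> f g /ffunP fg; apply/ffunP => i; have := fg i.
  by rewrite !ffunE => /perm_inj.
rewrite [RHS](reindex_inj inj_h); apply: eq_bigr => rho _.
rewrite msym_rename /rename; congr (_ \mPo _); apply: eq_mktuple => i.
by rewrite ffunE.
Qed.

Definition relation (F : {mpoly {poly K}[n]}) :=
  forall N : nat, 'X^N %| F.@[fun i => trunc (sigma i) N].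

Definition specialized_value (G : {mpoly {poly K}[n]}) (z : 'I_n -> K) : K :=
  (G.@[fun i => (z i)%:P]).[eps0].

(* A generic combination of relations, each nonzero at one point, is nonzero at
   all of them. *)
Lemma branch_relation_nonvanishing (I : Type) (z : I -> 'I_n -> K) (s : seq I) :
    (forall t, exists2 G, relation G & specialized_value G (z t) != 0) ->
  exists2 G, relation G & all (fun t => specialized_value G (z t) != 0) s.
Proof.
move=> exG; elim: s => [|t s [G1 rel1 nz1]].
  by exists 0 => // N; rewrite meval0 dvdp0.
have [G2 rel2 nz2] := exG t.
(* The variable of [q] is the coefficient of [G2] in the combination. The factor at [t] is nonzero
   by [nz2], the others by [nz1], so some value [c] annihilates none of them. *)
pose q := ((specialized_value G1 (z t))%:P + specialized_value G2 (z t) *: 'X)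
  * \prod_(u <- s) ((specialized_value G1 (z u))%:P + specialized_value G2 (z u) *: 'X).
have /closed_nonrootP[c] : q != 0.
  rewrite mulf_neq0 //.
    apply: contraNneq nz2 => /(congr1 (coefp 1)).
    by rewrite /= coefD coefC coefZ coefX coef0 add0r mulr1 => ->.
  rewrite prodf_seq_neq0; apply: sub_all nz1 => u /=.
  apply: contraNneq => /(congr1 (coefp 0)).
  by rewrite /= coefD coefC coefZ coefX coef0 mulr0 addr0 => ->.
rewrite rootE hornerM mulf_eq0 horner_prod prodf_seq_eq0 negb_or => /andP[ct cs].
exists (G1 + c%:P *: G2).
  by move=> N; rewrite mevalD mevalZ dvdp_add ?dvdp_mull.
have valE u : specialized_value (G1 + c%:P *: G2) (z u) =
    ((specialized_value G1 (z u))%:P + specialized_value G2 (z u) *: 'X).[c].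
  by rewrite /specialized_value mevalD mevalZ !hornerE mulrC.
rewrite /= valE ct /=; rewrite -all_predC in cs.
by apply: sub_all cs => u /=; rewrite valE.
Qed.

Lemma specialization_exists (w : {poly K}) (F : {poly {poly K}})
    (idx : 'I_n -> 'I_M) (rho : nat -> 'I_M -> {poly K}) (r : 'I_M -> K) :
    w.[eps0] != 0 ->
    (forall N i, rho N (idx i) = trunc (sigma i) N) ->
    (forall N k, 'X^N %| (w *: \prod_i ('X - (rho N i)%:P) - F)`_k) ->
    (forall k, 'X - eps0%:P %| (w *: \prod_i ('X - (r i)%:P%:P) - F)`_k) ->
  exists f : 'I_n -> 'I_M, specializes sigma eps0 (fun i => r (f i)).
Proof.
move=> w0 rhoE rhoF rF; apply: NNPP => none.
have exG (f : {ffun 'I_n -> 'I_M}) :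
    exists2 G, relation G & specialized_value G (fun i => r (f i)) != 0.
  apply: NNPP => noG; apply: none; exists f => G relG.
  by apply/eqP; apply: contraT => nz; case: noG; exists G.
have [G relG nzG] := branch_relation_nonvanishing (enum {ffun 'I_n -> 'I_M}) exG.
have [D [h hP]] := symmetric_eval_congr w F (norm_mpoly_sym G).
(* The same [h] serves modulo every ['X^N] and modulo ['X - eps0]. The first congruences force
   [h = 0], as the norm contains the factor [G] at the branches; the last one then contradicts the
   choice of [G]. *)
have h0 : h = 0.
  have dvdh N : 'X^N %| h.
    have := hP _ _ (rhoF N); rewrite dvdp_subr; first by [].
    rewrite dvdp_mull // /norm_mpoly rmorph_prod /=.
    rewrite (bigD1 [ffun i => idx i]) //= dvdp_mulr // meval_rename.
    rewrite (meval_eq (v2 := fun i => trunc (sigma i) N)) // => i.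
    by rewrite ffunE rhoE.
  apply/eqP; apply: contraT => h_neq0.
  have := dvdp_leq h_neq0 (dvdh (size h)).
  by rewrite size_polyXn ltnn.
have := hP _ _ rF; rewrite h0 subr0 dvdp_XsubCl rootE hornerM horner_exp.
rewrite mulf_eq0 expf_eq0 (negbTE w0) andbF /= /norm_mpoly rmorph_prod horner_prod /=.
apply/negP/prodf_neq0 => f _; rewrite meval_rename.
by have /allP/(_ f) := nzG; rewrite mem_enum => /(_ isT).
Qed.

End LyingOver.

(** * The Bethe equation at a generic point *)

Lemma prod_periodic (R : comNzRingType) (G : nat -> R) p k :
  (forall j, G (j + p)%N = G j) -> \prod_(j < p) G (j + k)%N = \prod_(j < p) G j.
Proof.
move=> perG; elim: k => [|k <-].
  by apply: eq_bigr => j _; rewrite addn0.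
case: p perG => [|p] perG; first by rewrite !big_ord0.
rewrite big_ord_recr [RHS]big_ord_recl /= mulrC; congr (_ * _).
  by rewrite addnS -addSn addnC perG.
by apply: eq_bigr => j _; rewrite addnS.
Qed.

Section SimpleRoots.

Variables (K : fieldType) (I : finType) (c : I -> K).

Lemma deriv_prod_XsubC_neq0 t : injective c ->
  (\prod_i ('X - (c i)%:P))^`().[c t] != 0.
Proof.
move=> inj_c; rewrite (bigD1 t) //= derivM !derivE subr0 mul1r.
rewrite hornerD hornerM hornerXsubC subrr mul0r addr0 horner_prod.
apply/prodf_neq0 => i it; rewrite hornerXsubC subr_eq0 (inj_eq inj_c).
by rewrite eq_sym.
Qed.

Lemma deriv_prod_XsubC_double t u : t != u -> c t = c u ->
  (\prod_i ('X - (c i)%:P))^`().[c t] = 0.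
Proof.
move=> tu ctu; rewrite (bigD1 t) //= (bigD1 u) 1?eq_sym //= -ctu.
by rewrite derivM hornerD !hornerM !hornerXsubC subrr !(mul0r, mulr0) addr0.
Qed.

Lemma prod_XsubC_root_eq s : root (\prod_i ('X - (c i)%:P)) s -> exists t : I, s = c t.
Proof.
rewrite rootE horner_prod => /prodf_eq0[u _]; rewrite hornerXsubC subr_eq0 => /eqP->.
by exists u.
Qed.

End SimpleRoots.

Lemma poly_eq_horner (K : closedFieldType) (f g : {poly K}) :
  (forall v, f.[v] = g.[v]) -> f = g.
Proof.
move=> fg; apply/eqP; rewrite -subr_eq0; apply: contraT => /closed_nonrootP[v].
by rewrite rootE !hornerE fg subrr eqxx.
Qed.

Section BetheGeneric.

Variables (K : closedFieldType) (p n : nat).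
Hypothesis charKp : p \in [pchar K].
Variables (Lam : 'I_n -> K) (a : K) (x : 'I_n -> K).
Hypothesis x_generic : injective (@linear_factor K p n Lam a x).

Let p_gt0 : (0 < p)%N := prime_gt0 (pcharf_prime charKp).

Definition divisor_point (t : bool * 'I_n * 'I_p) : K :=
  let: (num, i, j) := t in x i - (if num then Lam i else 0) - a *+ j.

Lemma divisor_point_inj : injective divisor_point.
Proof.
move=> t u tu; apply: x_generic.
have E v : linear_factor Lam a x v = 'X - (divisor_point v)%:P.
  by case: v => [[num i] j] /=; rewrite !polyCB; ring.
by rewrite !E tu.
Qed.

Lemma mulrn_modp (u : K) k : u *+ (k %% p) = u *+ k.
Proof. by rewrite [in RHS](divn_eq k p) mulrnDr mulrnA (mulrn_pchar_eq0 charKp) add0r. Qed.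

Lemma divisor_point_mod num i k :
  divisor_point (num, i, Ordinal (ltn_pmod k p_gt0)) =
  x i - (if num then Lam i else 0) - a *+ k.
Proof. by rewrite /= mulrn_modp. Qed.

Lemma zero_neq_pole i l k : x i - Lam i - x l + a *+ k != 0.
Proof.
apply/eqP => e.
have : divisor_point (true, i, Ordinal (ltn_pmod 0 p_gt0)) =
    divisor_point (false, l, Ordinal (ltn_pmod k p_gt0)).
  by rewrite !divisor_point_mod; apply: subr0_eq; rewrite -[RHS]e /=; ring.
by move/divisor_point_inj.
Qed.

(** The bounds on [k] exclude the comparison of a zero with itself, at [l = i]. *)
Lemma zero_neq_zero i l k : (0 < k < p)%N -> x i - Lam i - x l + Lam l + a *+ k != 0.
Proof.
move=> /andP[k0 kp]; apply/eqP => e.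
have : divisor_point (true, i, Ordinal (ltn_pmod 0 p_gt0)) =
    divisor_point (true, l, Ordinal (ltn_pmod k p_gt0)).
  by rewrite !divisor_point_mod; apply: subr0_eq; rewrite -[RHS]e /=; ring.
move/divisor_point_inj => [_]; rewrite mod0n modn_small // => e'.
by rewrite -e' in k0.
Qed.

Lemma off_collisions_generic m : off_collisions Lam a m x.
Proof.
move=> i k _; have := zero_neq_pole m i k.
by congr (_ != 0); ring.
Qed.

(** Otherwise a zero and a pole attached to the same [x m] would coincide. This makes the
    eigenvalues depend injectively on [h_p p a s]. *)
Lemma h_p_Lam_neq0 m : h_p p a (Lam m) != 0.
Proof.
rewrite h_p_prod //; apply/prodf_neq0 => j _.
have := zero_neq_pole m m (p.-1 * j)%N; rewrite (mulrn_pred_pchar charKp).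
apply: contraNneq => e; apply/eqP.
by rewrite -[RHS]oppr0 -[in RHS]e; ring.
Qed.

Definition num_poly : {poly K} :=
  \prod_(l < n) \prod_(j < p) ('X - (x l)%:P + (Lam l)%:P + (a *+ j)%:P).
Definition den_poly : {poly K} :=
  \prod_(l < n) \prod_(j < p) ('X - (x l)%:P + (a *+ j)%:P).

Lemma num_polyE : num_poly = \prod_(t : 'I_n * 'I_p) ('X - (divisor_point (true, t.1, t.2))%:P).
Proof.
rewrite /num_poly pair_big; apply: eq_bigr => t _ /=.
by rewrite !polyCB; ring.
Qed.

Lemma den_polyE : den_poly = \prod_(t : 'I_n * 'I_p) ('X - (divisor_point (false, t.1, t.2))%:P).
Proof.
rewrite /den_poly pair_big; apply: eq_bigr => t _ /=.
by rewrite !polyCB subr0; ring.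
Qed.

Lemma divisor_point_num_inj num : injective (fun t : 'I_n * 'I_p => divisor_point (num, t.1, t.2)).
Proof. by move=> [i j] [k l] /divisor_point_inj[-> ->]. Qed.

Lemma num_den_neq0 s : (num_poly.[s] != 0) || (den_poly.[s] != 0).
Proof.
rewrite -negb_and; apply/negP => /andP[]; rewrite -!rootE num_polyE den_polyE.
by case/prod_XsubC_root_eq => [t ->] /prod_XsubC_root_eq[u] /divisor_point_inj.
Qed.

Lemma num_polyP s : num_poly.[s] = \prod_(i < n) h_p p a (s - x i + Lam i).
Proof.
rewrite horner_prod; apply: eq_bigr => i _.
by rewrite h_p_prod // horner_prod; apply: eq_bigr => j _; rewrite !hornerE.
Qed.

Lemma den_polyP s : den_poly.[s] = \prod_(i < n) h_p p a (s - x i).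
Proof.
rewrite horner_prod; apply: eq_bigr => i _.
by rewrite h_p_prod // horner_prod; apply: eq_bigr => j _; rewrite !hornerE.
Qed.

Section Solution.

Variables (kappa s : K).
Hypothesis kappa_neq0 : kappa != 0.
Hypothesis sol : kappa ^+ p * num_poly.[s] = den_poly.[s].

(** The equation makes [num_poly] and [den_poly] vanish together, and they have no common root. *)
Lemma solution_neq0 : (num_poly.[s] != 0) && (den_poly.[s] != 0).
Proof.
have := num_den_neq0 s; rewrite -sol mulf_eq0 expf_eq0 (negbTE kappa_neq0) andbF /=.
by rewrite orbb andbb.
Qed.

Lemma solution_h_p_neq0 i : (h_p p a (s - x i) != 0) && (h_p p a (s - x i + Lam i) != 0).
Proof.
have /andP[] := solution_neq0; rewrite num_polyP den_polyP.
by move=> /prodf_neq0 -> // /prodf_neq0 ->.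
Qed.

Lemma solution_off_divisors : off_divisors Lam a x s.
Proof.
move=> i k; have /andP[] := solution_h_p_neq0 i.
have nz u : h_p p a u != 0 -> u + a *+ k != 0.
  apply: contraNneq => e; have := congr1 (h_p p a) e.
  by rewrite h_pD // h_pMn // addr0 => ->; rewrite -(mulr0n a) h_pMn.
by move=> /nz-> /nz->.
Qed.

Lemma solution_bethe_equation : bethe_equation p Lam a kappa x s.
Proof.
rewrite /bethe_equation big_split /= prodfV -num_polyP -den_polyP mulrA sol mulfV //.
by have /andP[] := solution_neq0.
Qed.

End Solution.
End BetheGeneric.

(** * The finitely many exceptional points [s] *)

Section BetheNonzero.

Variables (K : closedFieldType) (p n : nat).
Hypothesis charKp : p \in [pchar K].
Variables (Lam : 'I_n -> K) (a : K) (x : 'I_n -> K).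
Hypothesis x_generic : injective (@linear_factor K p n Lam a x).
Variable i0 : 'I_n.
Hypothesis i0_min : forall l : 'I_n, (l < i0)%N = false.

Let p_gt0 : (0 < p)%N := prime_gt0 (pcharf_prime charKp).
Local Notation num := (num_poly p Lam a x).
Local Notation den := (den_poly p a x).
Local Notation c := (divisor_point Lam a x).

(** The Wronskian of numerator and denominator: it vanishes at every multiple root of
    [num - e *: den], whatever [e] is. *)
Definition double_root_poly : {poly K} := num^`() * den - num * den^`().

(** At a zero of the numerator, which is simple and not a pole, only the first term survives. *)
Lemma double_root_poly_neq0 : double_root_poly != 0.
Proof.
pose t : bool * 'I_n * 'I_p := (true, i0, Ordinal p_gt0).
have numt : num.[c t] = 0.
  rewrite num_polyE horner_prod (bigD1 (i0, Ordinal p_gt0)) //=.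
  by rewrite hornerXsubC subrr mul0r.
have nz := num_den_neq0 x_generic (c t); rewrite numt eqxx /= in nz.
apply/closed_nonrootP; exists (c t).
rewrite rootE /double_root_poly hornerD hornerN !hornerM numt mul0r subr0.
rewrite mulf_neq0 // num_polyE.
apply: (@deriv_prod_XsubC_neq0 _ _ (fun u : 'I_n * 'I_p => c (true, u.1, u.2))
  (i0, Ordinal p_gt0)).
exact: divisor_point_num_inj.
Qed.

Lemma double_root_poly_eq0 e s :
  num.[s] = e * den.[s] -> (num - e *: den)^`().[s] = 0 -> double_root_poly.[s] = 0.
Proof.
move=> ns; rewrite derivB derivZ hornerD hornerN hornerZ => /eqP.
rewrite subr_eq0 => /eqP ns'.
by rewrite /double_root_poly hornerD hornerN !hornerM ns ns'; ring.
Qed.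

(* [bethe_term_poly d] is the [d]-th summand of the [i0]-th entry of the Bethe
   vector, cleared of the denominators of [Phi] and of [kappa ^+ d]. *)
Definition bethe_term_poly d : {poly K} :=
  (\prod_(j < p) \prod_(l < n)
     ('X + (a *+ j - x l + (if (j < d)%N then Lam l else a))%:P)) *
  \prod_(l < n | (i0 < l)%N) ('X + (a *+ d - x l)%:P).

(* Since [kappa ^+ p = den / num] and raising to the power [p] is additive, this
   is the [p]-th power of the [i0]-th entry of the Bethe vector with [kappa]
   eliminated. *)
Definition bethe_norm_poly : {poly K} :=
  \sum_(d < p) den ^+ d * num ^+ (p.-1 - d) * bethe_term_poly d ^+ p.

Lemma bethe_term_polyE kappa s d : off_divisors Lam a x s -> (d <= p)%N ->
  (\prod_(j < d) Phi Lam a kappa x (s + a *+ j)) * W Lam x (s + a *+ d) i0 0 *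
    (\prod_(j < p) \prod_(l < n) (s + a *+ j - x l + a)) =
  kappa ^+ d * (bethe_term_poly d).[s].
Proof.
move=> offs dp; rewrite mxE /bethe_term_poly hornerM !horner_prod.
have -> : \prod_(l < n | (l < i0)%N) (s + a *+ d - x l + Lam l) = 1.
  by apply: big_pred0.
rewrite mul1r [LHS]mulrAC mulrA; congr (_ * _); last first.
  by apply: eq_bigr => l _; rewrite !hornerE.
have -> : \prod_(j < d) Phi Lam a kappa x (s + a *+ j) =
    kappa ^+ d * \prod_(j < p | (j < d)%N) \prod_(l < n)
      ((s + a *+ j - x l + Lam l) / (s + a *+ j - x l + a)).
  rewrite -(big_ord_widen _ (fun j => \prod_(l < n)
      ((s + a *+ j - x l + Lam l) / (s + a *+ j - x l + a)))) //.
  by rewrite /Phi big_split /= prodr_const card_ord.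
rewrite -mulrA big_mkcond -big_split /=; congr (_ * _).
apply: eq_bigr => j _; rewrite horner_prod; case: ifP => _; last first.
  rewrite mul1r; apply: eq_bigr => l _; rewrite hornerD hornerX hornerC.
  by rewrite !addrA.
rewrite -big_split; apply: eq_bigr => l _ /=.
rewrite divfK; first by rewrite hornerD hornerX hornerC !addrA.
have /andP[] := offs l j.+1; rewrite mulrS => nz _.
by have := nz; congr (_ != 0); ring.
Qed.

Lemma bethe_norm_poly_eq0 kappa s : off_divisors Lam a x s ->
    kappa ^+ p * num.[s] = den.[s] ->
  bethe_vector p Lam a kappa x s = 0 -> bethe_norm_poly.[s] = 0.
Proof.
move=> offs sol bv0; have := congr1 (fun A : 'cV_n => A i0 0) bv0.
rewrite /bethe_vector summxE mxE => e.
have {}e : \sum_(d < p) kappa ^+ d * (bethe_term_poly d).[s] = 0.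
  rewrite -[RHS](mul0r (\prod_(j < p) \prod_(l < n) (s + a *+ j - x l + a))) -[in RHS]e.
  rewrite mulr_suml; apply: eq_bigr => d _.
  by rewrite [in RHS]mxE bethe_term_polyE // ltnW.
have := congr1 (pFrobenius_aut charKp) e; rewrite rmorph_sum rmorph0 /= => e'.
rewrite -[RHS](mulr0 (num.[s] ^+ p.-1)) -[in RHS]e' mulr_sumr /bethe_norm_poly horner_sum.
apply: eq_bigr => d _; move: (bethe_term_poly d) => T.
rewrite !hornerM !horner_exp pFrobenius_autE exprMn.
have dp : (d <= p.-1)%N by rewrite -ltnS prednK.
have -> : (kappa ^+ d) ^+ p = (kappa ^+ p) ^+ d by rewrite -!exprM mulnC.
rewrite -{1}sol exprMn -[in RHS](subnK dp) exprD.
by ring.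
Qed.

Lemma bethe_norm_poly_neq0 : bethe_norm_poly != 0.
Proof.
(* At this root of the numerator only the summand [d = p.-1] survives. Its numerator factors lie at
   offsets [1, ..., p.-1] in units of [a] from the zero [x i0 - Lam i0]; without the added [a] the
   offset [0] would occur, and that factor vanishes at [l = i0]. *)
apply/closed_nonrootP; exists (x i0 - Lam i0 + a).
set s := x i0 - Lam i0 + a.
have pm1 : (p.-1 < p)%N by rewrite prednK.
have num0 : num.[s] = 0.
  rewrite num_polyP // (bigD1 i0) //=.
  have -> : s - x i0 + Lam i0 = a *+ 1 by rewrite /s mulr1n; ring.
  by rewrite h_pMn // mul0r.
have den0 : den.[s] != 0.
  by have := num_den_neq0 x_generic s; rewrite num0 eqxx.
rewrite rootE /bethe_norm_poly horner_sum (bigD1 (Ordinal pm1)) //= big1 ?addr0; last first.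
  move=> d dp; rewrite !hornerM !horner_exp num0 expr0n subn_eq0 leqNgt.
  have -> : (d < p.-1)%N.
    by move: dp (ltn_ord d); rewrite -(inj_eq val_inj) /=; lia.
  by rewrite mulr0 mul0r.
rewrite subnn expr0 mulr1 hornerM !horner_exp mulf_neq0 ?expf_neq0 //.
rewrite /bethe_term_poly hornerM !horner_prod mulf_neq0 //.
  apply/prodf_neq0 => j _; rewrite horner_prod; apply/prodf_neq0 => l _.
  rewrite hornerD hornerX hornerC; case: ifP => jp.
    have j1p : (0 < j.+1 < p)%N by move: jp; lia.
    have := zero_neq_zero charKp x_generic i0 l j1p.
    rewrite mulrSr /s; apply: contraNneq => e; apply/eqP.
    by rewrite -[RHS]e; ring.
  have := zero_neq_pole charKp x_generic i0 l j.+2.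
  rewrite !mulrSr /s; apply: contraNneq => e; apply/eqP.
  by rewrite -[RHS]e; ring.
apply/prodf_neq0 => l _; rewrite hornerD hornerX hornerC.
have := zero_neq_pole charKp x_generic i0 l p.
rewrite -{1}(prednK p_gt0) mulrSr /s; apply: contraNneq => e; apply/eqP.
by rewrite -[RHS]e; ring.
Qed.

End BetheNonzero.

Lemma dvdp_horner (K : fieldType) (d u : {poly K}) (f : {poly {poly K}}) :
  (forall k, d %| f`_k) -> d %| f.[u].
Proof.
move=> df; rewrite horner_coef.
by elim/big_ind: _ => [|u1 u2|k _]; [exact: dvdp0|exact: dvdp_add|rewrite dvdp_mulr].
Qed.

(** * The branches of the Bethe equation and their values *)

Section Branches.

Variables (K : closedFieldType) (p n : nat).
Hypothesis charKp : p \in [pchar K].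
Variables (Lam : 'I_n -> K) (a : K) (x : 'I_n -> K).
Hypothesis x_generic : injective (@linear_factor K p n Lam a x).

Let p_gt0 : (0 < p)%N := prime_gt0 (pcharf_prime charKp).
Local Notation num := (num_poly p Lam a x).
Local Notation den := (den_poly p a x).
Local Notation c := (divisor_point Lam a x).

(** The outer variable is [s]; the inner one, in the coefficients, is eps. *)
Definition bethe_family : {poly {poly K}} := num^:P - 'X^p *: den^:P.

Lemma bethe_familyE u : bethe_family.[u] =
  \prod_(l < n) \prod_(j < p) (u - (x l)%:P + (Lam l)%:P + (a *+ j)%:P)
  - 'X^p * \prod_(l < n) \prod_(j < p) (u - (x l)%:P + (a *+ j)%:P).
Proof.
rewrite /bethe_family hornerD hornerN hornerZ !rmorph_prod !horner_prod.
congr (_ - _ * _); apply: eq_bigr => l _; rewrite rmorph_prod horner_prod.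
  by apply: eq_bigr => j _; rewrite !rmorphD rmorphN /= map_polyX !map_polyC !hornerE.
by apply: eq_bigr => j _; rewrite !rmorphD rmorphN /= map_polyX !map_polyC !hornerE.
Qed.

Lemma bethe_family_horner v e :
  (bethe_family.[v%:P]).[e] = num.[v] - e ^+ p * den.[v].
Proof.
rewrite /bethe_family hornerD hornerN hornerZ !horner_map /=.
by rewrite hornerD hornerN hornerM hornerXn !hornerC.
Qed.

(** Translation by a multiple of [a] permutes the linear factors, so each branch yields [p] roots of
    the family. *)
Lemma bethe_family_periodic u k : bethe_family.[u - (a *+ k)%:P] = bethe_family.[u].
Proof.
have shift_prod (b : {poly K}) :
    \prod_(j < p) (b - (a *+ k)%:P + (a *+ j)%:P) = \prod_(j < p) (b + (a *+ j)%:P).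
  rewrite -(@prod_periodic _ (fun j => b - (a *+ k)%:P + (a *+ j)%:P) p k).
    by apply: eq_bigr => j _; rewrite mulrnDr polyCD; ring.
  by move=> j; rewrite mulrnDr (mulrn_pchar_eq0 charKp) addr0.
rewrite !bethe_familyE; congr (_ - _ * _); apply: eq_bigr => l _.
  by rewrite -[RHS]shift_prod; apply: eq_bigr => j _; ring.
by rewrite -[RHS]shift_prod; apply: eq_bigr => j _; ring.
Qed.

Lemma num_poly_zero i : num.[x i - Lam i] = 0.
Proof.
rewrite num_polyE horner_prod (bigD1 (i, Ordinal p_gt0)) //=.
by rewrite hornerXsubC subr0 subrr mul0r.
Qed.

Definition branch (i : 'I_n) : nat -> K := hensel_series bethe_family (x i - Lam i).

Lemma bethe_family_root i : 'X %| bethe_family.[(x i - Lam i)%:P].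
Proof.
rewrite -['X]subr0 dvdp_XsubCl rootE bethe_family_horner num_poly_zero.
by rewrite expr0n gtn_eqF // mul0r subrr.
Qed.

Lemma bethe_family_simple i : (bethe_family^`().[(x i - Lam i)%:P]).[0] != 0.
Proof.
rewrite /bethe_family derivB derivZ !deriv_map hornerD hornerN hornerZ !horner_map /=.
rewrite hornerD hornerN hornerM hornerXn !hornerC expr0n gtn_eqF // mul0r subr0.
have -> : x i - Lam i = c (true, i, Ordinal p_gt0) by rewrite /= subr0.
rewrite num_polyE.
apply: (@deriv_prod_XsubC_neq0 _ _ (fun u : 'I_n * 'I_p => c (true, u.1, u.2))
  (i, Ordinal p_gt0)).
exact: divisor_point_num_inj.
Qed.

Lemma branchP i N : 'X^N %| bethe_family.[trunc (branch i) N].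
Proof. by apply: hensel_seriesP; [apply: bethe_family_root|apply: bethe_family_simple]. Qed.

Lemma branch_is_branch i : is_branch p Lam a x i (branch i).
Proof.
split; first by [].
by move=> N; rewrite -bethe_familyE branchP.
Qed.

Lemma branch_unique i g : is_branch p Lam a x i g -> g =1 branch i.
Proof.
case=> g0 gP; apply: hensel_unique g0 _ => [|N].
  exact: bethe_family_simple.
by rewrite bethe_familyE.
Qed.

Local Notation M := #|{: 'I_n * 'I_p}|.

(** Together with their translates the [n] branches account for all [n * p] roots: their constant
    terms are the distinct zeros of the numerator. *)
Definition conjugate_branch N (k : 'I_M) : {poly K} :=
  trunc (branch (enum_val k).1) N - (a *+ (enum_val k).2)%:P.

Lemma size_num_poly : (num \is monic) * (size num = M.+1).
Proof.
rewrite num_polyE; split; first exact: monic_prod_XsubC.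
by rewrite size_prod_XsubC /index_enum -enumT -cardE.
Qed.

Lemma size_den_poly : (den \is monic) * (size den = M.+1).
Proof.
rewrite (@den_polyE K p n Lam a x); split; first exact: monic_prod_XsubC.
by rewrite size_prod_XsubC /index_enum -enumT -cardE.
Qed.

Lemma conjugate_branch_split N k :
  'X^N %| ((1 - 'X^p) *: \prod_i ('X - (conjugate_branch N i)%:P) - bethe_family)`_k.
Proof.
(* Truncation at order [0] loses the constant terms that separate the nodes. *)
case: N => [|N]; first by rewrite dvd1p.
have wE : 1 - (1 - 'X^p) = 'X^p :> {poly K} by ring.
have -> : bethe_family = num^:P - (1 - (1 - 'X^p)) *: den^:P.
  by rewrite wE.
have polyC_inj := @polyC_inj K.
apply: dvdp_coef_split.
- move=> i j; rewrite /conjugate_branch !hornerD !hornerN !trunc_horner0 !hornerC => e.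
  apply: enum_val_inj; move: e; case: (enum_val i) (enum_val j) => [i1 i2] [j1 j2] /= e.
  by have /(divisor_point_inj x_generic)[-> ->] : c (true, i1, i2) = c (true, j1, j2).
- by rewrite map_monic // size_num_poly.
- by rewrite map_monic // size_den_poly.
- by rewrite size_map_inj_poly // size_num_poly.
- by rewrite size_map_inj_poly // size_den_poly.
- move=> i; rewrite wE -/bethe_family bethe_family_periodic.
  exact: branchP.
Qed.

Section Specialization.

Variables (e : K) (s : 'I_n -> K).
Hypothesis spec : specializes branch e s.

(** For each fixed value [v] of the variable, the factorization of the family over the branches and
    their translates is a polynomial relation, so it persists at the specialized point. *)
Lemma specialization_split :
  (1 - e ^+ p) *: \prod_(t : 'I_n * 'I_p) ('X - (s t.1 - a *+ t.2)%:P) =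
  num - e ^+ p *: den.
Proof.
apply: poly_eq_horner => v.
pose G : {mpoly {poly K}[n]} :=
  (1 - 'X^p) *: \prod_(t : 'I_n * 'I_p) ((v + a *+ t.2)%:P%:MP - 'X_t.1)
  - (bethe_family.[v%:P])%:MP.
have GE (u : 'I_n -> {poly K}) : G.@[u] =
    (1 - 'X^p) * \prod_(t : 'I_n * 'I_p) (v%:P - (u t.1 - (a *+ t.2)%:P)) - bethe_family.[v%:P].
  rewrite mevalB mevalZ mevalC rmorph_prod /=; congr (_ * _ - _).
  by apply: eq_bigr => t _; rewrite mevalB mevalC mevalXU polyCD; ring.
have relG N : 'X^N %| G.@[fun i => trunc (branch i) N].
  rewrite GE.
  have -> : \prod_(t : 'I_n * 'I_p) (v%:P - (trunc (branch t.1) N - (a *+ t.2)%:P)) =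
      (\prod_i ('X - (conjugate_branch N i)%:P)).[v%:P].
    rewrite horner_prod (reindex (@enum_val _ predT)) /=; last first.
      by exists enum_rank => t _; rewrite ?enum_rankK ?enum_valK.
    by apply: eq_bigr => t _; rewrite hornerXsubC.
  rewrite -hornerZ -hornerN -hornerD.
  exact/dvdp_horner/conjugate_branch_split.
have G0 := spec relG; rewrite GE in G0; move: (bethe_family_horner v e) G0.
move: (bethe_family.[v%:P]) => B BE G0.
rewrite hornerD hornerN BE in G0; move/subr0_eq: G0 => G0.
rewrite hornerM hornerD hornerN hornerXn hornerC horner_prod in G0.
rewrite hornerD hornerN !hornerZ -G0 horner_prod; congr (_ * _).
by apply: eq_bigr => t _; rewrite !hornerE.
Qed.

Hypothesis e_neq0 : e != 0.

Lemma specialization_solution i : (e^-1) ^+ p * num.[s i] = den.[s i].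
Proof.
have := congr1 (horner^~ (s i)) specialization_split.
rewrite hornerZ horner_prod (bigD1 (i, Ordinal p_gt0)) //= hornerXsubC subr0 subrr.
rewrite mul0r mulr0 hornerD hornerN hornerZ => /esym/eqP.
by rewrite subr_eq0 => /eqP->; rewrite exprVn mulKf // expf_neq0.
Qed.

(** If [h_p] agrees at [s i] and [s j], these differ by a multiple of [a]; for [i != j] the
    factorization then repeats a factor and [s i] is a multiple root, which [double_root_poly]
    excludes. *)
Lemma specialization_inj :
    (forall i, (double_root_poly p Lam a x).[s i] != 0) ->
  injective (fun i => h_p p a (s i)).
Proof.
move=> nz i j /eqP; rewrite -subr_eq0 -h_pN // -h_pD // h_p_prod //.
case/prodf_eq0 => k _ /eqP sk; apply/eqP; apply: contraT => ij.
have := nz i; rewrite (double_root_poly_eq0 (e := e ^+ p)) ?eqxx //.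
  by rewrite -specialization_solution exprVn mulVKf // expf_neq0.
rewrite -specialization_split derivZ hornerZ.
have := @deriv_prod_XsubC_double _ _ (fun t : 'I_n * 'I_p => s t.1 - a *+ t.2)
  (i, Ordinal p_gt0) (j, k).
rewrite /= subr0 => ->; first by rewrite mulr0.
  by rewrite xpair_eqE negb_and ij.
by apply/eqP; rewrite -subr_eq0 -[X in _ == X]sk; apply/eqP; ring.
Qed.

End Specialization.

(** The condition on [e] keeps the leading coefficient nonzero, so that the specialized polynomial
    has the full number [M] of roots, listed with multiplicity by [r]. *)
Lemma exists_specialization e : 1 - e ^+ p != 0 -> exists s, specializes branch e s.
Proof.
move=> w0; pose f := num - e ^+ p *: den.
have fM : f`_M = 1 - e ^+ p.
  have lc q : (q \is monic) * (size q = M.+1) -> q`_M = 1.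
    by case=> /monicP <- sz; rewrite lead_coefE sz.
  by rewrite coefB coefZ !lc ?mulr1 //; [exact: size_den_poly|exact: size_num_poly].
have size_f : size f = M.+1.
  apply/eqP; rewrite eqn_leq; apply/andP; split.
    rewrite (leq_trans (size_polyD _ _)) // geq_max size_num_poly leqnn size_polyN.
    by rewrite (leq_trans (size_scale_leq _ _)) // size_den_poly.
  by apply: contraTltn w0 => sz; rewrite -fM nth_default // eqxx.
have [rs fE] := closed_field_poly_normal f.
have lf : lead_coef f = 1 - e ^+ p by rewrite lead_coefE size_f.
have size_rs : size rs = M.
  have := size_f; rewrite fE size_scale ?lf // size_prod_XsubC.
  by case.
pose r (i : 'I_M) := rs`_i.
have := @specialization_exists K n M branch e (1 - 'X^p) bethe_family
  (fun i => enum_rank (i, Ordinal p_gt0)) conjugate_branch r.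
case.
- by rewrite hornerD hornerN hornerXn hornerC.
- by move=> N i; rewrite /conjugate_branch enum_rankK /= subr0.
- exact: conjugate_branch_split.
- move=> k; rewrite dvdp_XsubCl rootE.
  have -> : \prod_i ('X - (r i)%:P%:P) = (\prod_(z <- rs) ('X - z%:P))^:P.
    rewrite rmorph_prod (big_nth 0) size_rs big_mkord; apply: eq_bigr => i _.
    by rewrite /= rmorphB /= map_polyX map_polyC.
  rewrite coefB coefZ coefB coefZ !coef_map /= !hornerE.
  have := congr1 (fun q : {poly K} => q`_k) fE; rewrite lf coefB !coefZ => ->.
  by rewrite subrr.
by move=> idx spec; exists (fun i => r (idx i)).
Qed.

End Branches.

Theorem theoremB5 (K : closedFieldType) (p n : nat)
    (charKp : p \in [pchar K]) (p_gt2 : (2 < p)%N) (n_gt0 : (0 < n)%N)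
    (Lam : 'I_n -> K) (LamFp : forall i, in_Fp p (Lam i) && (Lam i != 0))
    (a : K) (aNFp : ~~ in_Fp p a)
    (x0 : 'I_n -> K) (x0_generic : injective (@linear_factor K p n Lam a x0)) :
  exists sigma : 'I_n -> nat -> K,
    (forall i, is_branch p Lam a x0 i (sigma i) /\
       (forall g, is_branch p Lam a x0 i g -> g =1 sigma i)) /\
    exists2 q : {poly K}, q != 0 &
      forall kappa : K, kappa != 0 -> q.[kappa] != 0 ->
      exists s0 : 'I_n -> K,
        [/\ injective s0,
            forall i, bethe_equation p Lam a kappa x0 (s0 i),
            specializes sigma kappa^-1 s0,
            (forall i, bethe_vector p Lam a kappa x0 (s0 i) != 0) /\
            basis_of {:'cV[K]_n}
              [seq bethe_vector p Lam a kappa x0 (s0 i) | i <- enum 'I_n]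
          & forall i m,
              p_curvature p Lam a kappa m x0
                *m bethe_vector p Lam a kappa x0 (s0 i) =
              (h_p p a (s0 i - x0 m) / h_p p a (s0 i - x0 m + Lam m))
                *: bethe_vector p Lam a kappa x0 (s0 i)].
Proof.
exists (branch p Lam a x0); split.
  move=> i; split=> [|g]; first exact: branch_is_branch.
  exact: branch_unique.
pose i0 := Ordinal n_gt0.
have i0_min (l : 'I_n) : (l < i0)%N = false by rewrite ltn0.
pose bad := double_root_poly p Lam a x0 * bethe_norm_poly p Lam a x0 i0.
have bad_neq0 : bad != 0.
  by rewrite mulf_neq0 ?double_root_poly_neq0 // bethe_norm_poly_neq0.
have [rs badE] := closed_field_poly_normal bad.
have p_gt0 : (0 < p)%N := prime_gt0 (pcharf_prime charKp).
pose num := num_poly p Lam a x0; pose den := den_poly p a x0.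
(* ['X^p - 1] prevents a drop of degree at [kappa^-1]. The factor at [r] vanishes exactly when [r]
   satisfies the Bethe equation for [kappa] cleared of denominators, so the solutions avoid the
   roots of [bad]. *)
exists (('X^p - 1) * \prod_(r <- rs) (num.[r] *: 'X^p - den.[r]%:P)).
  apply: mulf_neq0; first exact/monic_neq0/monicXnsubC.
  rewrite prodf_seq_neq0; apply/allP => r _ /=.
  have := num_den_neq0 x0_generic r; rewrite -/num -/den.
  apply: contraTneq => r0; rewrite negb_or !negbK.
  have := congr1 (coefp p) r0; have := congr1 (coefp 0) r0.
  rewrite /= !(coefB, coefZ, coefXn, coefC, coef0) eqxx (gtn_eqF p_gt0) (ltn_eqF p_gt0).
  by rewrite mulr0 sub0r mulr1 subr0 => /eqP; rewrite oppr_eq0 => -> ->; rewrite eqxx.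
move=> kappa kappa_neq0; rewrite hornerM mulf_eq0 negb_or => /andP[kp kr].
have kp1 : kappa ^+ p - 1 != 0 by move: kp; rewrite !hornerE.
have [|s spec] := exists_specialization charKp x0_generic (e := kappa^-1).
  apply: contraNneq kp1; rewrite exprVn => /subr0_eq e.
  by rewrite -[kappa ^+ p]invrK -e invr1 subrr.
have sol i : kappa ^+ p * num.[s i] = den.[s i].
  by rewrite -{1}[kappa]invrK (specialization_solution charKp x0_generic spec) ?invr_neq0.
have bad_s i : bad.[s i] != 0.
  apply: contraNneq kr => bs; rewrite horner_prod prodf_seq_eq0; apply/hasP.
  exists (s i); last by rewrite /= !hornerE mulrC sol subrr.
  move/eqP: bs; rewrite badE hornerZ mulf_eq0 lead_coef_eq0 (negbTE bad_neq0) /=.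
  by rewrite -rootE root_prod_XsubC.
have inj_h : injective (fun i => h_p p a (s i)).
  apply: (specialization_inj charKp x0_generic spec); first by rewrite invr_neq0.
  by move=> i; have := bad_s i; rewrite hornerM mulf_eq0 negb_or => /andP[].
have off i := solution_off_divisors charKp x0_generic kappa_neq0 (sol i).
have bae i := solution_bethe_equation charKp x0_generic kappa_neq0 (sol i).
have eig i m : p_curvature p Lam a kappa m x0 *m bethe_vector p Lam a kappa x0 (s i) =
    (h_p p a (s i - x0 m) / h_p p a (s i - x0 m + Lam m))
      *: bethe_vector p Lam a kappa x0 (s i).
  apply: p_curvature_bethe_vector => //.
    exact: (off_collisions_generic charKp x0_generic).
  by rewrite prod_PhiE //; apply: bae.
have bv_neq0 i : bethe_vector p Lam a kappa x0 (s i) != 0.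
  have := bad_s i; rewrite hornerM mulf_eq0 negb_or => /andP[_].
  by apply: contraNneq => bv0; rewrite (bethe_norm_poly_eq0 charKp _ (off i) (sol i) bv0).
exists s; split=> //.
  by move=> i j sij; apply: inj_h; rewrite sij.
(* The operator with [m = i0] alone separates the vectors: its eigenvalue is
   [u / (u + h_p p a (Lam i0))] with [u = h_p p a (s i - x0 i0)], which is injective in [u] because
   [h_p p a (Lam i0) != 0]. *)
split=> //; apply: (eigenvectors_basis (fun i => eig i i0)) => // i j.
have /andP[_] := solution_h_p_neq0 charKp x0_generic kappa_neq0 (sol i) i0.
have /andP[_] := solution_h_p_neq0 charKp x0_generic kappa_neq0 (sol j) i0.
have := h_p_Lam_neq0 charKp x0_generic i0.
rewrite !h_pD // => lam0 nzj nzi /eqP; rewrite eqr_div // => /eqP E.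
apply: inj_h; apply: (mulfI lam0); move: E; move: (h_p p a (Lam i0)) => l.
move: (h_p p a (s i)) (h_p p a (s j)) (h_p p a (- x0 i0)) => u v w E.
apply: subr0_eq; rewrite -[RHS](subrr ((u + w) * (v + w + l))) [X in _ = _ - X]E; ring.
Qed.
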